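(* Let $A$ be a ring with divisors with field of fractions $K$, let $L\supseteq K$ be a (discrete) field, and let $B$ be the integral closure of $A$ in $L$. 1. $B$ is a ring with divisors. 2. There is a unique morphism of lattice-ordered groups $\varphi:\mathrm{Div}\,A\to\mathrm{Div}\,B$ such that $\varphi(\mathrm{div}_A(a))=\mathrm{div}_B(a)$ for all nonzero $a\in A$. This morphism is injective; this allows one to identify $\mathrm{Div}\,A$ with a lattice-ordered subgroup of $\mathrm{Div}\,B$. 3. Let $x\in B$, $x\neq0$, and let $f\in A[X]$ be a monic polynomial of degree $d$ with $f(x)=0$. With $\xi=\mathrm{div}_B(x)$ and $D$ the lcm of the integers $1,\dots,d$, there are (finitely many) elements $\gamma_k\in\mathrm{Div}\,A\subseteq\mathrm{Div}\,B$, lying in the subgroup generated by the divisors of the (nonzero) coefficients of $f$, such that $\bigwedge_k|D\xi-\gamma_k|=0$.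
   Context: Rings are commutative with unit. A ring is integral if every element is zero or regular; $A^*$ is the set of regular elements, $K$ the total ring of fractions of $A$, $K^*$ its set of regular elements. An element $g\in A^*$ is a strong gcd of $(a_1,\dots,a_n)$ in $A^*$ if for every $x\in A^*$, $xg$ is a gcd of $(xa_1,\dots,xa_n)$ in $A$. A list $(a_i)$ in $A^*$ is divisorially invertible if there is a list $(b_j)$ in $A^*$ such that $(a_ib_j)_{i,j}$ has a strong gcd. An integral ring is a ring with divisors (PvMD) if every nonempty finite list in $A^*$ (equivalently every nonzero finitely generated ideal) is divisorially invertible. For a ring with divisors, $\mathrm{div}_A:K^*\to\mathrm{Div}\,A$ is the (unique up to unique isomorphism) group morphism to a lattice-ordered group such that: $\mathrm{div}_A(x)\ge 0\iff x\in A$; and every element of $\mathrm{Div}\,A$ is the infimum of a finite family of elements $\mathrm{div}_A(x)$, $x\in K^*$. In a lattice-ordered group, $|\xi|=\xi\vee(-\xi)$. A discrete field is a field with decidable equality. *)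

(* Defs.v *)
From HB Require Import structures.
From mathcomp Require Import all_boot all_order all_algebra.
From mathcomp Require Import boolp.

Set Implicit Arguments.
Unset Strict Implicit.
Unset Printing Implicit Defensive.

Import Order.TTheory GRing.Theory Num.Theory.
Local Open Scope ring_scope.

Section RingsWithDivisors.
Variable R : comPzRingType.
Implicit Types (x y g : R) (s t : seq R).

(* In a commutative ring, [GRing.lreg x] says that [x] is regular. *)
Definition integral_ring := forall x, x = 0 \/ GRing.lreg x.

Definition rdivides x y := exists z, y = x * z.

Definition is_gcd g s :=
  {in s, forall a, rdivides g a} /\
  forall h, {in s, forall a, rdivides h a} -> rdivides h g.

Definition is_strong_gcd g s :=
  GRing.lreg g /\
  forall x, GRing.lreg x -> is_gcd (x * g) [seq x * a | a <- s].

Definition divisorially_invertible s :=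
  exists t, {in t, forall b, GRing.lreg b} /\
  exists g, is_strong_gcd g [seq a * b | a <- s, b <- t].

Definition ring_with_divisors :=
  integral_ring /\
  forall s, s != [::] -> {in s, forall a, GRing.lreg a} ->
  divisorially_invertible s.

End RingsWithDivisors.

(* The library's joins of ordered and additive structures do not allow a      *)
(* further join with [Order.Lattice], hence the explicit meet and join.       *)
HB.mixin Record isLatticeGroup G of Num.POrderedZmodule G := {
  lg_meet : G -> G -> G;
  lg_join : G -> G -> G;
  lg_meetP : forall x y z : G, (z <= lg_meet x y) = (z <= x) && (z <= y);
  lg_joinP : forall x y z : G, (lg_join x y <= z) = (x <= z) && (y <= z);
  lg_leD2l : forall z x y : G, x <= y -> z + x <= z + y
}.

#[short(type="latticeGroupType")]
HB.structure Definition LatticeGroup :=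
  { G of Num.POrderedZmodule G & isLatticeGroup G }.

Section LatticeGroups.
Variables G H : latticeGroupType.

Definition lg_abs (x : G) : G := lg_join x (- x).

(* The infimum of the nonempty finite family [x :: s]. *)
Definition lg_inf (x : G) (s : seq G) : G := \big[lg_meet/x]_(y <- s) y.

Definition lg_morphism (phi : G -> H) :=
  [/\ zmod_morphism phi,
      {morph phi : x y / lg_meet x y} &
      {morph phi : x y / lg_join x y}].

End LatticeGroups.

(* [div] stands for a map defined on the nonzero fractions only: its value at *)
(* 0 is irrelevant and left unconstrained. The pair [(G, div)] is determined  *)
(* by these properties up to unique isomorphism.                              *)
Record is_div (R : idomainType) (G : latticeGroupType)
    (div : {fraction R} -> G) : Prop := IsDiv {
  div_mul : forall x y, x != 0 -> y != 0 -> div (x * y) = div x + div y;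
  div_ge0 : forall x, x != 0 -> (0 <= div x <-> exists a : R, x = tofrac a);
  div_inf : forall xi : G, exists (x : {fraction R}) (s : seq {fraction R}),
    [/\ x != 0, {in s, forall y, y != 0} & xi = lg_inf (div x) (map div s)]
}.

(* The integral closure in a field [L] of the image of [f], as a subtype of   *)
(* [L] carrying the induced ring structure.                                   *)
Section IntegralClosure.
Variables (R : comNzRingType) (L : fieldType) (f : {rmorphism R -> L}).

Definition integral_pred : {pred L} := fun x => `[< integralOver f x >].

Lemma integral_pred_subring : subring_closed integral_pred.
Proof.
split=> [|x y /asboolP ix /asboolP iy|x y /asboolP ix /asboolP iy].
- exact/asboolP/integral1.
- exact/asboolP/integral_sub.
- exact/asboolP/integral_mul.
Qed.

HB.instance Definition _ :=
  GRing.isSubringClosed.Build L integral_pred integral_pred_subring.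

Record integral_closure := IntegralClosure {
  integral_val :> L;
  integral_valP : integral_val \in integral_pred
}.

HB.instance Definition _ := [isSub for integral_val].
HB.instance Definition _ := [Choice of integral_closure by <:].
HB.instance Definition _ :=
  [SubChoice_isSubComNzRing of integral_closure by <:].

Definition integral_unit : pred integral_closure :=
  fun x => (val x != 0) && ((val x)^-1 \in integral_pred).

Definition integral_inv (x : integral_closure) : integral_closure :=
  insubd x (val x)^-1.

Lemma integral_mulVr : {in integral_unit, left_inverse 1 integral_inv *%R}.
Proof.
move=> x /andP[x0 ix]; apply: val_inj.
by rewrite rmorphM rmorph1 /= /integral_inv insubdK // mulVf.
Qed.

Lemma integral_unitP (x y : integral_closure) :
  y * x = 1 -> integral_unit x.
Proof.
move=> /(congr1 val); rewrite rmorphM rmorph1 /= => yx1.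
have x0 : val x != 0.
  by apply/eqP=> x0; move/eqP: yx1; rewrite x0 mulr0 eq_sym oner_eq0.
rewrite /integral_unit /= x0 /=; suff -> : (val x)^-1 = val y by apply: valP.
by apply: (mulIf x0); rewrite mulVf.
Qed.

Lemma integral_inv_out : {in [predC integral_unit], integral_inv =1 id}.
Proof.
move=> x; rewrite inE /= => nux; apply: val_inj; rewrite /integral_inv val_insubd.
case: ifP => // ix; move: nux; rewrite /in_mem /= /integral_unit ix andbT negbK.
by move/eqP=> ->; rewrite invr0.
Qed.

HB.instance Definition _ := GRing.ComNzRing_hasMulInverse.Build integral_closure
  integral_mulVr integral_unitP integral_inv_out.

Lemma integral_closure_domain : GRing.integral_domain_axiom integral_closure.
Proof.
move=> x y /(congr1 val); rewrite rmorphM rmorph0 /= => /eqP.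
by rewrite mulf_eq0 => /orP[] /eqP e; apply/orP; [left|right]; apply/eqP/val_inj.
Qed.

HB.instance Definition _ :=
  GRing.ComUnitRing_isIntegral.Build integral_closure integral_closure_domain.

Lemma integral_base_subproof (a : R) : f a \in integral_pred.
Proof. exact/asboolP/integral_id. Qed.

Definition integral_base (a : R) : integral_closure :=
  IntegralClosure (integral_base_subproof a).

End IntegralClosure.

(* The restriction to [A] of an extension [iota] of its field of fractions. *)
Definition frac_restrict (A : idomainType) (L : fieldType)
    (iota : {rmorphism {fraction A} -> L}) : {rmorphism A -> L} :=
  GRing.RMorphism.clone A L (iota \o @tofrac A) _.

(* Main.v *)
Require Import Defs.
From HB Require Import structures.
From mathcomp Require Import all_boot all_order all_algebra generic_quotient.
From mathcomp Require Import boolp ring.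

Set Implicit Arguments.
Unset Strict Implicit.
Unset Printing Implicit Defensive.

Import Order.TTheory GRing.Theory Num.Theory.
Local Open Scope ring_scope.

(* Three facts carry the proof.                                               *)
(* - Gauss and Kronecker: over an integrally closed subring [O] of a field,   *)
(*   [p * q \in O[X]] forces every [p_i * q_j] into [O]. By Dedekind-Mertens, *)
(*   [p_i * q_j] stabilizes the module spanned by the degree [m] monomials in *)
(*   the coefficients of [p], [m] being the degree of [q], so it is integral. *)
(* - Strong gcds of [A] remain strong gcds in [B]: if all [z * e] are         *)
(*   integral, the [e] having strong gcd 1, then the minimal polynomial of    *)
(*   [z * e] has coefficients [m_i * e ^ (n - i)] in [A], where [m] is that   *)
(*   of [z]; hence all [m_i] are in [A] and [z] is integral.                  *)
(* - A polynomial [h] over [B] has a multiple [h * g] over [A], as [h] is     *)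
(*   integral over [A[X]]. The ideal of coefficients of [h * g] is            *)
(*   divisorially invertible in [A], so that of [h] is so in [B].             *)
(* Divisors are infima of [div (c / a)], and their order is expressed by      *)
(* divisibility in the ring, which is the same in [A] and in [B]. For the     *)
(* last claim, [u_i = div p_i + i * xi] satisfies [u_i >= \meet_(j != i) u_j] *)
(* since the terms [p_i * x ^ i] have sum zero, hence                         *)
(* [\meet_(i < j) |u_j - u_i| = 0], and [D * xi - gamma_ij] is                *)
(* [D / (j - i)] times [u_j - u_i].                                           *)

(** Everything turns on [vdivides], membership in the divisorial closure of a list. The order of
    divisors is expressed by it ([ideal_divisor_le]), and on lists of [A] it has the same meaning in
    [A] and in [B] ([vdivides_integral_base]). So sending the divisor of a list over [A] to the
    divisor of the same list over [B] preserves and reflects the order: this is [phi], well defined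
    and injective, and forced because every divisor is a finite infimum of principal ones
    ([div_extension]). The passage from [A] to [B] is [vdivides_integral]. It rests on Gauss's lemma
    [integral_coef_mul], drawn from [dedekind_mertens]. The same lemma gives
    [integral_closure_with_divisors], once a polynomial over [B] has been multiplied into one over
    [A]. The last claim is a Newton polygon argument: for a valuation, two terms of [p(x) = 0] share
    the minimal value, so the value of [x] is a slope. In a lattice group, being one of the slopes
    becomes the vanishing of an infimum of absolute differences ([lg_abs_differences]), and [D]
    clears the denominators of the slopes ([lg_disjointMn]). *)

Section DedekindMertens.
Variables (F : comNzRingType) (O : subringClosed F).

Inductive lin_span (X : F -> Prop) : F -> Prop :=
| span0 : lin_span X 0
| spanD a x y : a \in O -> X x -> lin_span X y -> lin_span X (a * x + y).

Lemma span_gen (X : F -> Prop) x : X x -> lin_span X x.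
Proof.
by move=> Xx; rewrite -[x]mul1r -[_ * _]addr0; apply: spanD (rpred1 _) Xx _;
  left.
Qed.

Lemma span_add (X : F -> Prop) x y : lin_span X x -> lin_span X y ->
  lin_span X (x + y).
Proof.
move=> Xx Xy; elim: Xx => [|a {}x z Oa Xx _ IH]; first by rewrite add0r.
by rewrite -addrA; apply: spanD.
Qed.

Lemma span_sum (X : F -> Prop) I (r : seq I) (P : pred I) (E : I -> F) :
  (forall i, P i -> lin_span X (E i)) -> lin_span X (\sum_(i <- r | P i) E i).
Proof. by move=> XE; apply: big_ind => //; [left | apply: span_add]. Qed.

Lemma span_mul (X Y : F -> Prop) u z :
  (forall x, X x -> lin_span Y (u * x)) -> lin_span X z -> lin_span Y (u * z).
Proof.
move=> XY; elim=> [|a x y Oa Xx _ IH]; first by rewrite mulr0; left.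
rewrite mulrDr; apply: span_add => //.
rewrite mulrCA; elim: (XY x Xx) => [|b v w Ob Yv _ IHw].
  by rewrite mulr0; left.
by rewrite mulrDr mulrA; apply: spanD => //; apply: rpredM.
Qed.

Lemma span_opp (X : F -> Prop) x : lin_span X x -> lin_span X (- x).
Proof.
elim=> [|a v y Oa Xv _ IH]; first by rewrite oppr0; left.
by rewrite opprD -mulNr; apply: spanD => //; rewrite rpredN.
Qed.

Fixpoint monomials (s : seq F) k : seq F :=
  if k is k'.+1 then [seq a * b | a <- s, b <- monomials s k'] else [:: 1].

Definition span_content (p c : {poly F}) k : F -> Prop :=
  lin_span (fun x => exists2 u, u \in monomials p k & exists j, x = u * c`_j).

Lemma span_content_gen (p c : {poly F}) k u j :
  u \in monomials p k -> span_content p c k (u * c`_j).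
Proof. by move=> pu; apply: span_gen; exists u => //; exists j. Qed.

Lemma span_content_coef (p c : {poly F}) k z i :
  span_content p c k z -> span_content p c k.+1 (p`_i * z).
Proof.
apply: span_mul => x [u pu [j ->]]; rewrite mulrA.
have [lt_ip|le_pi] := ltnP i (size p); last first.
  by rewrite nth_default // !mul0r; left.
by apply: span_content_gen; apply: allpairs_f => //; apply: mem_nth.
Qed.

(** Induction on [m], splitting off the top term of [q]. The coefficients of [p * q'] differ from
    those of [p * q] by multiples of the top coefficient of [q], so all reduces to the products of
    that coefficient with monomials in the coefficients of [p]. *)
Lemma dedekind_mertens (p q : {poly F}) m j w :
  (size q <= m.+1)%N -> w \in monomials p m.+1 ->
  span_content p (p * q) m (q`_j * w).
Proof.
elim: m => [|m IH] in q j w *.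
  move=> sq /allpairsP[[a b] /= [/(nthP 0)[i _ <-] /[!inE]/eqP-> ->]].
  rewrite mulr1; case: j => [|j]; last first.
    by rewrite nth_default ?mul0r; [left | apply: leq_trans sq _].
  have -> : q`_0 * p`_i = 1 * (p * q)`_i.
    by rewrite [q in RHS](size1_polyC sq) coefMC mulrC mul1r.
  by apply: span_content_gen; rewrite inE.
move=> sq pw; set c := p * q.
pose q' := q - q`_m.+1 *: 'X^(m.+1).
have q'E i : q'`_i = if i == m.+1 then 0 else q`_i.
  rewrite coefB coefZ coefXn mulr_natr mulrb.
  by case: eqP => [->|_]; rewrite ?subrr ?subr0.
have sq' : (size q' <= m.+1)%N.
  apply/leq_sizeP => i le_mi; rewrite q'E; case: eqP => // /eqP ne_i.
  by rewrite nth_default // (leq_trans sq) // ltn_neqAle eq_sym ne_i.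
have cE i : (p * q')`_i = c`_i - q`_m.+1 * (p * 'X^(m.+1))`_i.
  by rewrite mulrBr coefB -scalerAr coefZ.
have low i u k : u \in monomials p m.+1 ->
    (forall v, v \in monomials p m.+1 ->
      span_content p c m.+1 (q`_m.+1 * (p`_i * v))) ->
    span_content p c m.+1 (p`_i * (q'`_k * u)).
  move=> pu Hi; have := IH q' k u sq' pu; apply: span_mul => x [v pv [l ->]].
  rewrite cE mulrBr mulrBr; apply: span_add.
    by apply: span_content_coef; apply: span_content_gen.
  apply: span_opp; rewrite coefMXn; case: ifP => _.
    by rewrite !mulr0; left.
  have [lt_lp|le_pl] := ltnP (l - m.+1) (size p); last first.
    by rewrite [_`_(l - _)]nth_default // !mulr0; left.
  rewrite (mulrCA v) (mulrCA p`_i) [v * _]mulrC; apply: Hi.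
  by apply: allpairs_f => //; apply: mem_nth.
(* Descending induction on [i]: the coefficient of index [i + m.+1] of [p * q] isolates the wanted
   product, and since [q'] has degree at most [m], the other terms involve coefficients of [p] of
   index greater than [i]. *)
have top i u : u \in monomials p m.+1 ->
    span_content p c m.+1 (q`_m.+1 * (p`_i * u)).
  have [n] := ubnP (size p - i); elim: n => // n IHn in i u *.
  have [lt_ip|le_pi _ _] := ltnP i (size p); last first.
    by rewrite [p`_i]nth_default // mul0r mulr0; left.
  rewrite ltnS => le_n pu.
  have -> : q`_m.+1 * (p`_i * u) = u * c`_(i + m.+1)
      - \sum_(k < (i + m.+1).+1) p`_(i + m.+1 - k) * (q'`_k * u).
    under eq_bigr do rewrite mulrA.
    rewrite -mulr_suml -coefMr cE coefMXn ltnNge leq_addl /= addnK.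
    by rewrite mulrBl [u * _]mulrC opprB addrC subrK mulrA.
  apply: span_add; first exact: span_content_gen.
  apply: span_opp; apply: span_sum => k _.
  have [le_km|lt_mk] := leqP k m; last first.
    by rewrite [q'`_k]nth_default ?mul0r ?mulr0;
      [left | apply: leq_trans lt_mk].
  have lt_ik : (i < i + m.+1 - k)%N.
    by rewrite -addnBA ?leqW // -[ltnLHS]addn0 ltn_add2l subn_gt0.
  apply: low => // v pv; apply: IHn => //; apply: leq_trans le_n.
  exact: ltn_sub2l.
case/allpairsP: pw => [[a b] /= [/(nthP 0)[i _ <-] pb ->]].
have [->|ne_j] := eqVneq j m.+1; first exact: top.
have -> : q`_j * (p`_i * b) = p`_i * (q'`_j * b).
  by rewrite q'E (negPf ne_j) mulrCA.
by apply: low => // v; apply: top.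
Qed.

End DedekindMertens.

(** * Integrality of products of coefficients *)

Section Gauss.
Variables (R : comNzRingType) (L : fieldType) (f : {rmorphism R -> L}).
Local Notation O := (integral_pred f).

Lemma integralP x : reflect (integralOver f x) (x \in O).
Proof. exact: asboolP. Qed.

Lemma span_coords (s : seq L) x :
  lin_span O (fun v => v \in s) x ->
  exists2 c : 'I_(size s) -> L,
    forall i, c i \in O & x = \sum_i c i * s`_i.
Proof.
elim=> [|a {}x y Oa /(nthP 0)[i lt_is <-] _ [c Oc ->]].
  by exists (fun=> 0) => [i|]; rewrite ?rpred0 ?big1 // => i; rewrite mul0r.
exists (fun j : 'I_(size s) => a *+ (j == i :> nat) + c j) => [j|].
  by rewrite rpredD // rpredMn.
under [RHS]eq_bigr do rewrite mulrDl.
rewrite big_split /=; congr (_ + _).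
rewrite (bigD1 (Ordinal lt_is)) //= eqxx big1 ?addr0 // => j ne_ji.
by rewrite -val_eqE /= in ne_ji; rewrite (negPf ne_ji) mul0r.
Qed.

(** The determinant trick: multiplication by [z] on the generators has a matrix over [O], of which
    [z] is an eigenvalue because [v != 0]. Its characteristic polynomial is monic over [O], and
    integrality is transitive. *)
Lemma integral_stable (s : seq L) z v :
  v \in s -> v != 0 ->
  {in s, forall x, lin_span O (fun v => v \in s) (z * x)} -> z \in O.
Proof.
move=> /(nthP 0)[i0 lt_i0 <-] nz_v sz.
have /fin_all_exists2[c Oc zE] (i : 'I_(size s)) :=
  span_coords (sz _ (mem_nth 0 (ltn_ord i))).
pose A := \matrix_(j, i) c i j.
have: eigenvalue A z.
  apply/eigenvalueP; exists (\row_i s`_i).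
    by apply/rowP=> i; rewrite !mxE zE; apply: eq_bigr => j _;
      rewrite !mxE mulrC.
  by apply/eqP=> /rowP/(_ (Ordinal lt_i0)); rewrite !mxE /=; apply/eqP.
rewrite eigenvalue_root_char => rz.
have OA : char_poly A \is a polyOver O.
  rewrite rpred_sum // => s' _; rewrite rpredMsign rpred_prod // => i _.
  rewrite !mxE rpredB ?rpredMn ?polyOverX // polyOverC; exact: Oc.
apply/integralP; apply: integral_root_monic (char_poly_monic A) rz _.
by apply/integral_poly => i; apply/integralP/(polyOverP OA).
Qed.

(** By [dedekind_mertens], the product stabilizes the [O]-span of the degree [m] monomials in the
    coefficients of [p]; a power of the leading coefficient is a nonzero element of it. *)
Lemma integral_coef_mul (p q : {poly L}) i j :
  (forall k, (p * q)`_k \in O) -> p`_i * q`_j \in O.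
Proof.
move=> Opq; have [lt_ip|] := ltnP i (size p); last first.
  by move=> le_pi; rewrite nth_default // mul0r rpred0.
have p_neq0 : p != 0 by rewrite -size_poly_gt0 (leq_ltn_trans _ lt_ip).
pose m := (size q).-1.
have lm : lead_coef p ^+ m \in monomials p m.
  elim: m => [|m IH]; first by rewrite inE.
  rewrite exprS; apply: allpairs_f => //.
  by apply: mem_nth; rewrite prednK // size_poly_gt0.
apply: (integral_stable lm) => [|w pw].
  by rewrite expf_neq0 // lead_coef_eq0.
rewrite mulrAC [_ * w * _]mulrC.
have pw' : p`_i * w \in monomials p m.+1.
  by apply: allpairs_f => //; apply: mem_nth.
have := dedekind_mertens O j (leqSpred (size q)) pw'.
rewrite -[q`_j * _]mul1r -[X in lin_span _ _ X]mul1r;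
  apply: span_mul => x [u pu [k ->]].
rewrite mul1r mulrC -[_ * u]addr0; apply: spanD => //; exact: span0.
Qed.

End Gauss.

Lemma lreg_domain (R : idomainType) (x : R) : GRing.lreg x <-> x != 0.
Proof. by split=> [/lreg_neq0 //|/mulfI]. Qed.

(** * Strong gcds and divisorial closure *)

Section Divisors.
Variable R : idomainType.
Implicit Types (a c g h x : R) (s t : seq R).

(* [vdivides s c] says that [c] lies in the divisorial closure of the ideal   *)
(* generated by [s], the fraction [x / h] being written without denominator.  *)
Definition vdivides s c := forall x h, h != 0 ->
  {in s, forall a, rdivides h (x * a)} -> rdivides h (x * c).

Lemma rdividesMl x a b : rdivides a b -> rdivides a (x * b).
Proof. by case=> z ->; exists (x * z); rewrite mulrCA. Qed.

Lemma rdividesM2l x a b : x != 0 -> rdivides (x * a) (x * b) <-> rdivides a b.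
Proof.
move=> nz_x; split=> [[z]|[z ->]]; last by exists z; rewrite mulrA.
by rewrite -mulrA => /(mulfI nz_x) ->; exists z.
Qed.

Lemma rdivides_sum a I (r : seq I) (P : pred I) (E : I -> R) :
  (forall i, P i -> rdivides a (E i)) -> rdivides a (\sum_(i <- r | P i) E i).
Proof.
move=> aE; apply: (big_ind (rdivides a)) => //; first by exists 0;
  rewrite mulr0.
by move=> _ _ [u ->] [v ->]; exists (u + v); rewrite mulrDr.
Qed.

(** Asking [x * g] to be a gcd for every regular [x] tests [g] against all fractions [x / h]. A
    nonzero member of [s] forces any common divisor [h] to be nonzero. *)
Lemma strong_gcdP g s : s != [::] -> {in s, forall a, a != 0} ->
  is_strong_gcd g s <->
  [/\ g != 0, {in s, forall a, rdivides g a} & vdivides s g].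
Proof.
case: s => // a0 s _; set s0 := a0 :: s => nz_s.
have s0a : a0 \in s0 by rewrite mem_head.
split=> [[/lreg_domain nz_g gcd_g]|[nz_g dvd_g vdvd_g]].
  split=> // [a sa|x h nz_h hx].
    have [dvd_g _] := gcd_g 1 (@lreg1 R).
    by rewrite -[g]mul1r -[a]mul1r; apply/dvd_g/map_f.
  have [->|nz_x] := eqVneq x 0; first by exists 0; rewrite mul0r mulr0.
  have [_ max_g] := gcd_g x ((lreg_domain x).2 nz_x).
  by apply: max_g => _ /mapP[a sa ->]; apply: hx.
split=> [|x /lreg_domain nz_x]; first exact/lreg_domain.
split=> [_ /mapP[a sa ->]|h hx].
  by apply/(rdividesM2l _ _ nz_x)/dvd_g.
apply: vdvd_g => [|a sa]; last exact/hx/map_f.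
apply/eqP=> h0; have /hx[z] : x * a0 \in [seq x * a | a <- s0] by apply: map_f.
by rewrite h0 mul0r; apply/eqP; rewrite mulf_neq0 // nz_s.
Qed.

(* Powers of the members of [s] can replace them one at a time.               *)
Lemma vdivides_exp s N u v : vdivides s 1 -> v != 0 ->
  {in s, forall a, rdivides v (u * a ^+ N)} -> rdivides v u.
Proof.
move=> vs nz_v us.
(* [t] collects the members whose exponent has already been lowered to 1. *)
suff: forall t,
    (forall u, {in s ++ t, forall a, rdivides v (u * a)} -> rdivides v u) ->
    forall u, {in s, forall a, rdivides v (u * a ^+ N)} ->
      {in t, forall a, rdivides v (u * a)} -> rdivides v u.
  by move=> /(_ [::]); apply=> // w; rewrite cats0 => ws; rewrite -[w]mulr1;
    apply: vs.
elim: s {vs u us} => [|a s IH] t vt u us ut; first exact: vt.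
have {vt}K w : {in s, forall b, rdivides v (w * b ^+ N)} ->
    {in a :: t, forall b, rdivides v (w * b)} -> rdivides v w.
  apply: IH => {}w vw; apply: vt => b sb; apply: vw; move: sb.
  by rewrite !mem_cat !inE orbCA orbA.
have := us a (mem_head _ _); elim: (N in a ^+ N) => [|M IHM].
  by rewrite mulr1.
move=> va; apply: IHM; apply: K => b sb; rewrite mulrAC.
  by rewrite mulrC; apply: rdividesMl; apply: us; rewrite inE sb orbT.
move: sb; rewrite inE => /predU1P[->|tb].
  by rewrite mulrAC -mulrA -exprSr.
by rewrite mulrC; apply: rdividesMl; apply: ut.
Qed.

End Divisors.

Lemma allpairs_eq0 (S T U : eqType) (h : S -> T -> U) (s : seq S) (t : seq T) :
  ([seq h x y | x <- s, y <- t] == [::]) = (s == [::]) || (t == [::]).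
Proof. by rewrite -size_eq0 size_allpairs muln_eq0 !size_eq0. Qed.

Lemma divisorially_invertibleP (R : idomainType) (s : seq R) :
  s != [::] -> {in s, forall a, a != 0} ->
  divisorially_invertible s <->
  exists t : seq R, {in t, forall b, b != 0} /\ exists g,
    [/\ t != [::], g != 0,
        {in s & t, forall a b, rdivides g (a * b)} &
        vdivides [seq a * b | a <- s, b <- t] g].
Proof.
move=> s0 nz_s.
have prod_neq0 (t : seq R) : {in t, forall b, b != 0} ->
    {in [seq a * b | a <- s, b <- t], forall c, c != 0}.
  by move=> nz_t _ /allpairsP[[a b] /= [sa tb ->]];
    rewrite mulf_neq0 ?(nz_s a) ?(nz_t b).
have prod_nil (t : seq R) : t != [::] -> [seq a * b | a <- s, b <- t] != [::].
  by move=> t0; rewrite allpairs_eq0 negb_or s0.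
split=> [[t [reg_t [g gcd_g]]]|[t [nz_t [g [t0 nz_g dvd_g vdvd_g]]]]].
  have nz_t : {in t, forall b, b != 0} by move=> b /reg_t /lreg_domain.
  (* With [t] empty, [g] would be a gcd of the empty list, hence divisible by 0. *)
  have t0 : t != [::].
    apply/eqP=> t0; move: gcd_g; rewrite {}t0 allpairs0r =>
      -[/lreg_domain nz_g].
    move=> /(_ 1 (@lreg1 R)) [_ /(_ 0)] [] // z.
    by rewrite mul1r mul0r => g0; rewrite g0 eqxx in nz_g.
  have [nz_g dvd_g vdvd_g] :=
    (strong_gcdP g (prod_nil _ t0) (prod_neq0 _ nz_t)).1 gcd_g.
  exists t; split=> //; exists g; split=> // a b sa tb.
  by apply: dvd_g; apply: allpairs_f.
exists t; split=> [b /nz_t /lreg_domain //|]; exists g.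
apply/(strong_gcdP g (prod_nil _ t0) (prod_neq0 _ nz_t)); split=> //.
by move=> _ /allpairsP[[a b] /= [sa tb ->]]; apply: dvd_g.
Qed.

(** * A ring with divisors is integrally closed *)

Section BaseRing.
Variables (A : idomainType) (L : fieldType) (f : {rmorphism A -> L}).
Hypothesis f_inj : injective f.
Hypothesis pvmd_A : ring_with_divisors A.
Local Notation O := (integral_pred f).

Lemma inj_morph_eq0 a : (f a == 0) = (a == 0).
Proof. by rewrite -(rmorph0 f) (inj_eq f_inj). Qed.

(* A fraction [a / b] that is a root of a monic polynomial of degree [n]      *)
(* stabilizes the ideal generated by the [a ^ i * b ^ (n - 1 - i)], i < n,    *)
(* which can be cancelled since it is divisorially invertible.                *)
Lemma integral_frac_divides a b :
  b != 0 -> f a / f b \in O -> rdivides b a.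
Proof.
move=> nz_b /integralP[p mon_p root_p].
have [->|nz_a] := eqVneq a 0; first by exists 0; rewrite mulr0.
have [n sp] : exists n, size p = n.+1.
  by exists (size p).-1; rewrite prednK // size_poly_gt0 monic_neq0.
(* The monic equation of [a / b] times [b ^+ n], pulled back to [A]. *)
have Epow : a ^+ n = - \sum_(i < n) b * (p`_i * (a ^+ i * b ^+ (n.-1 - i))).
  apply/f_inj; move/rootP: root_p; rewrite horner_coef size_map_poly_id0;
    last first.
    by rewrite (monicP mon_p) rmorph1 oner_eq0.
  have nz_fb : f b != 0 by rewrite inj_morph_eq0.
  rewrite sp big_ord_recr /= coef_map; have := monicP mon_p.
  rewrite lead_coefE sp /= => ->;
    rewrite rmorph1 mul1r => /(congr1 ( *%R^~ (f b ^+ n))).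
  rewrite mul0r mulrDl -exprMn divfK // rmorphXn addrC => /eqP;
    rewrite addr_eq0 => /eqP->.
  rewrite rmorphN rmorph_sum mulr_suml; congr (- _); apply: eq_bigr => i _.
  rewrite coef_map !rmorphM !rmorphXn /= expr_div_n.
  have -> : f b ^+ n = f b ^+ i * (f b * f b ^+ (n.-1 - i)).
    by rewrite -exprS -exprD; congr (_ ^+ _); case: n i {sp} => [[]|n i] //=;
      rewrite -subSn ?subnKC ?leqW // -ltnS.
  by field; rewrite expf_neq0.
have n_gt0 : (0 < n)%N.
  case: n Epow {sp} => // /eqP; rewrite big_ord0 oppr0 expr0 oner_eq0 //.
pose s := [seq a ^+ i * b ^+ (n.-1 - i) | i <- iota 0 n].
have s0 : s != [::] by rewrite -size_eq0 size_map size_iota -lt0n n_gt0.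
have nz_s : {in s, forall c, c != 0}.
  by move=> _ /mapP[i _ ->]; rewrite mulf_neq0 // expf_neq0.
have invs : divisorially_invertible s.
  by apply: pvmd_A.2 => // c /nz_s /lreg_domain.
have [t [nz_t [g [t0 nz_g dvd_g vdvd_g]]]] :=
  (divisorially_invertibleP s0 nz_s).1 invs.
apply/(rdividesM2l _ _ nz_g); rewrite mulrC [g * a]mulrC; apply: vdvd_g.
  by rewrite mulf_neq0.
move=> _ /allpairsP[[c e] /= [sc te ->]].
have sdvd i : (i < n)%N -> rdivides g (a ^+ i * b ^+ (n.-1 - i) * e).
  by move=> lt_in; apply: dvd_g => //; apply: map_f; rewrite mem_iota.
case/mapP: sc => i; rewrite mem_iota add0n => /andP[_ lt_in] ->.
suff [c' Ec' dvd_c'] : exists2 c', a * (a ^+ i * b ^+ (n.-1 - i)) = b * c' &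
    rdivides g (c' * e).
  by rewrite mulrA Ec'; case: dvd_c' => w; rewrite -mulrA => ->; exists w;
    rewrite mulrA.
(* Multiplying a generator by [a] gives [b] times the next one; for the last it gives [a ^+ n],
   rewritten by [Epow]. *)
rewrite mulrA -exprS; have [lt_i1n|le_ni1] := ltnP i.+1 n.
  exists (a ^+ i.+1 * b ^+ (n.-1 - i.+1)); last exact: sdvd.
  rewrite [RHS]mulrCA -exprS; congr (_ * _ ^+ _).
  by rewrite -subSn ?subSS // -ltnS prednK.
have -> : i.+1 = n by apply/eqP; rewrite eqn_leq le_ni1 lt_in.
have -> : (n.-1 - i = 0)%N by apply/eqP; rewrite subn_eq0 -ltnS prednK.
exists (\sum_(i < n) - (p`_i * (a ^+ i * b ^+ (n.-1 - i)))).
  by rewrite mulr1 Epow sumrN mulrN mulr_sumr.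
rewrite mulr_suml; apply: rdivides_sum => j _.
by rewrite -mulNr -mulrA; apply: rdividesMl; apply: sdvd.
Qed.

End BaseRing.

Lemma fraction_quotient (R : idomainType) (x : {fraction R}) :
  exists a b, b != 0 /\ x = tofrac a / tofrac b.
Proof.
elim/quotW: x => x; exists (\n_x), (\d_x).
have nz_d : \d_x != 0 by apply: denom_ratioP.
split=> //; have nz_td : tofrac \d_x != 0 by rewrite tofrac_eq0.
apply: (mulIf nz_td); rewrite divfK //; unlock FracField.tofrac.
rewrite -[LHS]FracField.pi_mul; apply/eqmodP.
rewrite /= FracField.equivfE /FracField.mulf !numden_Ratio ?mulf_neq0 ?oner_eq0
  //.
by rewrite !mulr1 mulrC.
Qed.

Lemma minimal_polynomial (K L : fieldType) (iota : {rmorphism K -> L}) z :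
  algebraicOver iota z ->
  exists m : {poly K}, [/\ m \is monic, root (map_poly iota m) z &
    forall q, root (map_poly iota q) z -> m %| q].
Proof.
move=> [p0 nz_p0 p0z].
pose P n := `[< exists p, [/\ p != 0, root (map_poly iota p) z & size p = n] >].
have exP : exists n, P n by exists (size p0); apply/asboolP; exists p0.
have [_ /asboolP[p [nz_p pz <-]] min_p] := ex_minnP exP.
have nz_lp : (lead_coef p)^-1 != 0 by rewrite invr_eq0 lead_coef_eq0.
exists ((lead_coef p)^-1 *: p); split=> [||q qz].
- by rewrite monicE lead_coefZ mulVf // lead_coef_eq0.
- by rewrite linearZ rootE hornerZ (rootP pz) mulr0.
rewrite dvdpZl //; apply/eqP/eqP/idPn => nz_r.
have := min_p (size (q %% p)); rewrite leqNgt ltn_modp nz_p => /implyP.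
rewrite implybF => /negP[]; apply/asboolP; exists (q %% p); split=> //.
move: qz; rewrite {1}(divp_eq q p) rmorphD rmorphM rootE !hornerE /=.
by rewrite (rootP pz) mulr0 add0r.
Qed.

Lemma coef_comp_polyZX (R : comNzRingType) (p : {poly R}) c i :
  (p \Po (c *: 'X))`_i = c ^+ i * p`_i.
Proof.
rewrite comp_polyE.
under eq_bigr do rewrite exprZn scalerA mulrC.
by rewrite -(poly_def _ (fun i => c ^+ i * p`_i)) coef_poly;
  case: ltnP => // le_pi; rewrite nth_default ?mulr0.
Qed.

Lemma monic_mul_lead_coef (K : fieldType) (P q m : {poly K}) x n :
  x != 0 -> P \is monic -> P = q * m -> lead_coef m = x^-1 ^+ n ->
  lead_coef q = x ^+ n.
Proof.
move=> nz_x mon_P PE lead_m; move: (monicP mon_P); rewrite PE lead_coefM lead_m.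
by move/(congr1 ( *%R^~ (x ^+ n))); rewrite mul1r exprVn divfK ?expf_neq0.
Qed.

Lemma mulf_exp_subn (K : fieldType) (u v x : K) i n :
  x != 0 -> (i <= n)%N -> u * x ^+ (n - i) / v = x ^+ n * (x^-1 ^+ i * (u / v)).
Proof.
move=> nz_x le_in; rewrite -{2}(subnK le_in) exprD -[RHS]mulrA exprVn.
by rewrite [x ^+ i * _]mulrA mulfV ?expf_neq0 // mul1r mulrA [u * _]mulrC.
Qed.

(** * Divisorial closure in the integral closure *)

Section Extension.
Variables (A : idomainType) (L : fieldType).
Variable iota : {rmorphism {fraction A} -> L}.
Hypothesis pvmd_A : ring_with_divisors A.
Local Notation f := (frac_restrict iota).
Local Notation O := (integral_pred f).

Lemma tofrac_inj (R : idomainType) : injective (@tofrac R).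
Proof. by move=> a b /eqP; rewrite tofrac_eq => /eqP. Qed.

Lemma frac_restrict_inj : injective f.
Proof. by move=> a b /fmorph_inj /tofrac_inj. Qed.

Lemma frac_restrict_eq0 a : (f a == 0) = (a == 0).
Proof. exact: inj_morph_eq0 frac_restrict_inj a. Qed.

(** Let [m], of degree [n], be the minimal polynomial of [z]. If [P] is monic over [A] with root
    [z * e], then [m] divides [P(e X)], and Gauss's lemma applied to the resulting factorization of
    [P] puts [e ^+ (n - i)] times the [i]-th coefficient of [m] into [A]. This holds for all [e], so
    [vdivides_exp] removes the powers. *)
Lemma vdivides1_integral (s : seq A) z :
  s != [::] -> {in s, forall e, e != 0} -> vdivides s 1 ->
  {in s, forall e, z * f e \in O} -> z \in O.
Proof.
move=> s0 nz_s vs Os.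
have map_f p : map_poly f p = map_poly iota (map_poly (@tofrac A) p).
  by rewrite -map_poly_comp.
have alg_z : algebraicOver iota z.
  case: s s0 nz_s Os {vs} => // e s _ nz_s Os.
  have nz_e : f e != 0 by rewrite frac_restrict_eq0 nz_s ?mem_head.
  rewrite -[z](mulfK nz_e); apply: algebraic_div; last exact: algebraic_id.
  have /integralP[p mon_p] := Os e (mem_head _ _).
  rewrite map_f; exists (map_poly (@tofrac A) p) => //.
  by rewrite map_poly_eq0_id0 ?monic_neq0 // (monicP mon_p) rmorph1 oner_eq0.
have [m [mon_m mz min_m]] := minimal_polynomial alg_z.
apply/integralP; apply: integral_root_monic mz _; first by rewrite map_monic.
apply/integral_poly => i; rewrite coef_map /=.
suff [a ->] : exists a, m`_i = tofrac a by apply: (integral_id f).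
have [u [v [nz_v mi]]] := fraction_quotient m`_i.
have nz_fv : tofrac v != 0 by rewrite tofrac_eq0.
suff [a uE] : rdivides v u.
  by exists a; rewrite mi uE rmorphM mulrAC mulfV // mul1r.
have [le_im|lt_mi] := leqP i (size m).-1; last first.
  move: mi; rewrite nth_default; last first.
    by rewrite -ltnS prednK ?size_poly_gt0 ?monic_neq0 // ltnS in lt_mi *.
  move/eqP; rewrite eq_sym mulf_eq0 invr_eq0 (negPf nz_fv) orbF tofrac_eq0.
  by move/eqP->; exists 0; rewrite mulr0.
apply: (vdivides_exp (N := (size m).-1 - i) vs) => // e se.
have nz_e : tofrac e != 0 by rewrite tofrac_eq0 nz_s.
have /integralP[p mon_p] := Os e se; rewrite map_f => pz.
set P := map_poly _ p in pz; have mon_P : P \is monic by apply: monic_map.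
have OP k : P`_k \in integral_pred (@tofrac A).
  by rewrite coef_map; apply/integralP/integral_id.
clearbody P.
have /dvdpP[q defP] : m %| P \Po (tofrac e *: 'X).
  apply: min_m; rewrite map_comp_poly map_polyZ map_polyX rootE horner_comp.
  by rewrite !hornerE mulrC.
pose c := (tofrac e)^-1 *: 'X : {poly {fraction A}}.
have PE : P = (q \Po c) * (m \Po c).
  rewrite -comp_polyM -defP -comp_polyA comp_polyZ comp_polyX.
  by rewrite scalerA mulfV // scale1r comp_polyXr.
have lead_m : lead_coef (m \Po c) = (tofrac e)^-1 ^+ (size m).-1.
  rewrite lead_coef_comp ?size_scale ?size_polyX ?invr_eq0 //.
  by rewrite (monicP mon_m) mul1r lead_coefZ lead_coefX mulr1.
have lead_q : lead_coef (q \Po c) = tofrac e ^+ (size m).-1.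
  exact: monic_mul_lead_coef mon_P PE lead_m.
apply: (integral_frac_divides (@tofrac_inj A) pvmd_A) => //.
(* The leading coefficient is [e ^+ n], and the other factor is the [i]-th coefficient of [m]
   divided by [e ^+ i]. *)
have H : lead_coef (q \Po c) * (m \Po c)`_i \in integral_pred (@tofrac A).
  by rewrite lead_coefE; apply: integral_coef_mul => k; rewrite -PE.
rewrite lead_q coef_comp_polyZX mi in H.
by rewrite rmorphM rmorphXn /= mulf_exp_subn.
Qed.

(** Dividing the list by [g] reduces to the case where 1 is in the divisorial closure. *)
Lemma vdivides_integral (s : seq A) g z :
  s != [::] -> {in s, forall e, e != 0} -> {in s, forall e, rdivides g e} ->
  vdivides s g -> {in s, forall e, z * f e \in O} -> z * f g \in O.
Proof.
move=> s0 nz_s dvd_g vs Os.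
have /cid[q qE] : exists q : A -> A, {in s, forall e, e = g * q e}.
  have /choice[q qE] : forall e, exists w, e \in s -> e = g * w.
    by move=> e; case: (boolP (e \in s)) => [/dvd_g[w ->]|_];
      [exists w | exists 0].
  by exists q => e /qE.
apply: (vdivides1_integral (s := map q s)).
- by case: s s0 {nz_s dvd_g vs Os qE}.
- move=> _ /mapP[e se ->]; apply: contraNneq (nz_s e se) => q0.
  by rewrite (qE e) // q0 mulr0.
- have nz_g : g != 0.
    case: s s0 nz_s dvd_g {vs Os qE} => // e s _ nz_s dvd_g.
    have [w eE] := dvd_g e (mem_head _ _).
    by apply: contraNneq (nz_s e (mem_head _ _)) => g0; rewrite eE g0 mul0r.
  move=> x h nz_h hq; rewrite mulr1; apply/(rdividesM2l _ _ nz_g).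
  rewrite [g * x]mulrC; apply: vs => [|e se]; first by rewrite mulf_neq0.
  by rewrite (qE e) // mulrCA; apply/(rdividesM2l _ _ nz_g)/hq/map_f.
by move=> _ /mapP[e se ->]; rewrite -mulrA -rmorphM -qE //; apply: Os.
Qed.
Local Notation B := (integral_closure f).
Local Notation base := (integral_base f).

Lemma integral_base_zmod_morphism : zmod_morphism base.
Proof.
by move=> a b; apply: val_inj; rewrite [RHS]rmorphB -[LHS]/(f (a - b)) rmorphB.
Qed.

Lemma integral_base_monoid_morphism : monoid_morphism base.
Proof.
split=> [|a b]; apply: val_inj; first by rewrite [RHS]rmorph1 -(rmorph1 f).
by rewrite [RHS]rmorphM -[LHS]/(f (a * b)) rmorphM.
Qed.

HB.instance Definition _ :=
  GRing.isZmodMorphism.Build A B base integral_base_zmod_morphism.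
HB.instance Definition _ :=
  GRing.isMonoidMorphism.Build A B base integral_base_monoid_morphism.

Lemma integral_valM (x y : B) : val (x * y) = val x * val y.
Proof. exact: (rmorphM (val : B -> L)). Qed.

Lemma val_integral_base a : val (base a) = f a.
Proof. by []. Qed.

Lemma integral_base_inj : injective base.
Proof. by move=> a b /(congr1 (@integral_val _ _ _)) /frac_restrict_inj. Qed.

Lemma integral_base_eq0 a : (base a == 0) = (a == 0).
Proof. by rewrite -(inj_eq integral_base_inj) rmorph0. Qed.

Lemma integral_val_eq0 (x : B) : (val x == 0) = (x == 0).
Proof. by rewrite -[RHS](inj_eq val_inj) [val 0]rmorph0. Qed.

Lemma rdivides_integral_closure (a b : B) : b != 0 ->
  rdivides b a <-> val a / val b \in O.
Proof.
rewrite -integral_val_eq0 => nz_b; split=> [[z ->]|Oab].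
  by rewrite rmorphM mulrAC mulfV // mul1r; apply: integral_valP.
exists (IntegralClosure Oab); apply: val_inj.
by rewrite rmorphM /= mulrCA mulfV // mulr1.
Qed.

(** [h] is integral over [A[X]]. In an equation for [h], factors [h] are cancelled until the
    constant term [c] is nonzero; the equation then exhibits [c] as a multiple of [h]. *)
Lemma integral_poly_multiple (h : {poly L}) : h != 0 -> h \is a polyOver O ->
  exists g (c : {poly A}),
    [/\ g \is a polyOver O, c != 0 & map_poly f c = h * g].
Proof.
move=> nz_h Oh.
have [P mon_P] : integralOver (map_poly f) h.
  (* The value at the indeterminate of a polynomial with constant coefficients, each integral over
     [A[X]]. *)
  have -> : h = (map_poly polyC h).['X].
    by rewrite -/(comp_poly 'X h) comp_polyXr.
  apply: integral_horner; last by rewrite -(map_polyX f); apply: integral_id.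
  apply/integral_poly => i; rewrite coef_map.
  have /integralP[p mon_p pz] := polyOverP Oh i.
  exists (map_poly polyC p); first exact: monic_map.
  rewrite -map_poly_comp.
  have -> : map_poly (map_poly f \o polyC) p = map_poly polyC (map_poly f p).
    by rewrite -map_poly_comp; apply: eq_map_poly => a /=; rewrite map_polyC.
  by rewrite rootE horner_map (rootP pz) rmorph0.
have := monic_neq0 mon_P; move: {mon_P}P; apply: poly_ind => [|P c IH].
  by rewrite eqxx.
have [->|nz_c] := eqVneq c 0.
  rewrite addr0 mulf_eq0 polyX_eq0 orbF rmorphM /= map_polyX => nz_P.
  by rewrite rootM rootX (negPf nz_h) orbF; apply: IH.
move=> _ /rootP; rewrite rmorphD rmorphM /= map_polyX map_polyC !hornerE.
rewrite addrC => /eqP; rewrite addr_eq0 => /eqP fc.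
exists (- (map_poly (map_poly f) P).[h]), c; split=> //; last first.
  by rewrite fc mulrN mulrC.
rewrite rpredN rpred_horner //; apply/polyOverP => i; rewrite coef_map.
by apply/polyOverP => j; rewrite coef_map; apply/integralP/integral_id.
Qed.

(** The list is made the coefficients of [h], and [c = h g] has coefficients in [A]. If [t] inverts
    those of [c] with strong gcd [y], then the products of the coefficients of [g] with [t] invert
    the list, with the same gcd. *)
Lemma integral_closure_with_divisors : ring_with_divisors B.
Proof.
split=> [x|s s0 reg_s].
  by have [->|nz_x] := eqVneq x 0; [left | right; apply/lreg_domain].
have nz_s : {in s, forall a, a != 0} by move=> a /reg_s /lreg_domain.
apply/divisorially_invertibleP => //.
pose h := Poly (map (val : B -> L) s).
have hE i : h`_i = val s`_i.
  rewrite coef_Poly; have [lt_is|le_si] := ltnP i (size s).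
    by rewrite (nth_map 0).
  by rewrite !nth_default ?size_map // rmorph0.
have Oh : h \is a polyOver O.
  by apply/polyOverP => i; rewrite hE; apply: integral_valP.
have nz_h : h != 0.
  case: s s0 nz_s @h hE {reg_s Oh} => // a s _ nz_s h hE.
  apply: contraNneq (nz_s a (mem_head _ _)) => h0.
  by rewrite -integral_val_eq0 -(hE 0%N) h0 coef0.
have [g [c [Og nz_c cE]]] := integral_poly_multiple nz_h Oh.
pose cs := [seq a <- c : seq A | a != 0].
have nz_cs : {in cs, forall a, a != 0} by move=> a;
  rewrite mem_filter => /andP[].
have cs_lead : lead_coef c \in cs.
  by rewrite mem_filter lead_coef_eq0 nz_c mem_nth // prednK // size_poly_gt0.
have cs0 : cs != [::] by apply: contraTneq cs_lead => ->.
have invcs : divisorially_invertible cs.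
  by apply: pvmd_A.2 => // a /nz_cs /lreg_domain.
have [t [nz_t [y [t0 nz_y dvd_y vdvd_y]]]] :=
  (divisorially_invertibleP cs0 nz_cs).1 invcs.
pose gB j : B := IntegralClosure (polyOverP Og j).
pose js := [seq j <- index_iota 0 (size g) | g`_j != 0].
pose T := [seq gB j * base b | j <- js, b <- t].
have fc k : f c`_k = \sum_(i < k.+1) h`_i * g`_(k - i).
  by rewrite -coefM -cE coef_map.
have nz_fy : f y != 0 by rewrite frac_restrict_eq0.
have T0 : T != [::].
  have nz_g : g != 0.
    apply: contraNneq nz_c => g0; rewrite -lead_coef_eq0.
    rewrite -frac_restrict_eq0 lead_coefE fc.
    by rewrite big1 // => i _; rewrite g0 coef0 mulr0.
  have jl : (size g).-1 \in js.
    rewrite mem_filter -lead_coefE lead_coef_eq0 nz_g mem_index_iota /=.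
    by rewrite prednK // size_poly_gt0.
  by rewrite allpairs_eq0 (negPf t0) orbF; apply: contraTneq jl => ->.
have nz_base b : b != 0 -> base b != 0 by rewrite integral_base_eq0.
have nz_T : {in T, forall b, b != 0}.
  move=> _ /allpairsP[[j b] /= [jj tb ->]]; rewrite mulf_neq0 ?nz_base ?nz_t //.
  by rewrite -integral_val_eq0; move: jj; rewrite mem_filter => /andP[].
exists T; split=> //; exists (base y); rewrite nz_base //; split=> //.
(* The coefficients of [(b / y) h g] lie in [A], so Gauss's lemma makes each [(b / y) h_i g_j]
   integral. *)
- move=> _ _ /(nthP 0)[i lt_is <-] /allpairsP[[j b] /= [jj tb ->]].
  apply/rdivides_integral_closure; first exact: nz_base.
  have -> : val (s`_i * (gB j * base b)) / val (base y) =
      (f b / f y *: h)`_i * g`_j.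
    rewrite coefZ hE !integral_valM -[val (gB j)]/(g`_j) !val_integral_base.
    by field.
  apply: integral_coef_mul => k; rewrite -scalerAl -cE coefZ coef_map /=.
  have [->|nz_ck] := eqVneq c`_k 0; first by rewrite rmorph0 mulr0 rpred0.
  have ck : c`_k \in cs.
    rewrite mem_filter nz_ck; apply: mem_nth; rewrite ltnNge.
    by apply: contraNN nz_ck => le_ck; rewrite nth_default.
  have [w wE] := dvd_y _ _ ck tb.
  have -> : f b / f y * f c`_k = f w.
    apply: (mulIf nz_fy); rewrite mulrAC divfK // -!rmorphM.
    by rewrite mulrC wE mulrC.
  exact/integralP/integral_id.
(* Each [c_k b] is a sum of products [h_i g_j b], so [vdivides_integral] transfers the gcd property
   of [y] to [B]. *)
move=> x h' nz_h' hx; apply/rdivides_integral_closure => //.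
rewrite integral_valM mulrAC val_integral_base.
apply: (vdivides_integral _ _ _ vdvd_y).
- by rewrite allpairs_eq0 negb_or cs0.
- move=> _ /allpairsP[[e b] /= [se tb ->]].
  by rewrite mulf_neq0 ?(nz_cs e) ?(nz_t b).
- by move=> _ /allpairsP[[e b] /= [se tb ->]]; apply: dvd_y.
move=> _ /allpairsP[[e b] /= [+ tb ->]].
rewrite mem_filter => /andP[_ /(nthP 0)[k _ <-]].
rewrite -[iota _]/(f (c`_k * b)) (rmorphM f) fc mulr_suml mulr_sumr rpred_sum //
  => i _.
set j := (k - i)%N.
have [->|nz_gj] := eqVneq g`_j 0; first by rewrite mulr0 mul0r mulr0 rpred0.
have [lt_is|le_si] := ltnP i (size s); last first.
  by rewrite hE nth_default // rmorph0 !mul0r mulr0 rpred0.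
have /rdivides_integral_closure : rdivides h' (x * (s`_i * (gB j * base b))).
  apply: hx; apply: allpairs_f; first exact: mem_nth.
  apply: allpairs_f => //; rewrite mem_filter nz_gj mem_index_iota /= ltnNge.
  by apply: contraNN nz_gj => le_gj; rewrite nth_default.
have -> : val x / val h' * (h`_i * g`_j * f b) =
    val x * (val s`_i * (g`_j * f b)) / val h' by rewrite hE mulrAC !mulrA.
by rewrite !integral_valM val_integral_base; apply.
Qed.

(** Downwards, the test fractions of [A] are among those of [B] and [A] is integrally closed.
    Upwards, if [t] inverts [s] with strong gcd [g], then [g] divides [b * c] for each [b] in [t],
    and [vdivides_integral] applies to the products of [s] and [t]. *)
Lemma vdivides_integral_base (s : seq A) c :
  s != [::] -> {in s, forall e, e != 0} ->
  vdivides (map base s) (base c) <-> vdivides s c.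
Proof.
move=> s0 nz_s; split=> vs x h nz_h hx.
  have /rdivides_integral_closure : rdivides (base h) (base x * base c).
    apply: vs => [|_ /mapP[e se ->]]; first by rewrite integral_base_eq0.
    by have [w E] := hx e se; exists (base w); rewrite -!rmorphM E.
  rewrite integral_base_eq0 -rmorphM => /(_ nz_h).
  by apply: integral_frac_divides; first apply: frac_restrict_inj.
apply/rdivides_integral_closure => //; rewrite rmorphM mulrAC.
have invs : divisorially_invertible s.
  by apply: pvmd_A.2 => // a /nz_s /lreg_domain.
have [t [nz_t [g [t0 nz_g dvd_g vdvd_g]]]] :=
  (divisorially_invertibleP s0 nz_s).1 invs.
have nz_fg : f g != 0 by rewrite frac_restrict_eq0.
set z := _ / _; rewrite /= -[z * _](divfK nz_fg).
apply: (vdivides_integral _ _ _ vdvd_g).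
- by rewrite allpairs_eq0 negb_or s0.
- by move=> _ /allpairsP[[e b] /= [se tb ->]];
  rewrite mulf_neq0 ?(nz_s e) ?(nz_t b).
- by move=> _ /allpairsP[[e b] /= [se tb ->]]; apply: dvd_g.
move=> _ /allpairsP[[e b] /= [se tb ->]].
have [w wE] : rdivides g (b * c).
  by apply: vs => // e' se'; rewrite mulrC; apply: dvd_g.
have -> : z * f c / f g * f (e * b) = z * f e * f w.
  rewrite rmorphM.
  have -> : f w = f b * f c / f g by rewrite -rmorphM wE rmorphM mulrAC mulfV
    ?mul1r.
  by field.
have Oze : z * f e \in O.
  have /rdivides_integral_closure : rdivides h (x * base e) by apply/hx/map_f.
  by rewrite rmorphM mulrAC; apply.
by rewrite rpredM //; apply/integralP/integral_id.
Qed.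
End Extension.

(** * Finite infima in lattice-ordered groups *)

Section LatticeGroupTheory.
Variable G : latticeGroupType.
Implicit Types (x y z w : G) (l m : seq G).

Lemma lg_leD2l z x y : (z + x <= z + y) = (x <= y).
Proof.
apply/idP/idP=> [/(lg_leD2l (- z))|]; last exact: lg_leD2l.
by rewrite !addKr.
Qed.

Lemma lg_leD2r z x y : (x + z <= y + z) = (x <= y).
Proof. by rewrite ![_ + z]addrC lg_leD2l. Qed.

Lemma lg_leD x y z w : x <= y -> z <= w -> x + z <= y + w.
Proof.
by move=> le_xy le_zw; rewrite (@le_trans _ _ (y + z)) ?lg_leD2l ?lg_leD2r.
Qed.

Lemma lg_leBlDr x y z : (x - y <= z) = (x <= z + y).
Proof. by rewrite -[LHS](lg_leD2r y) subrK. Qed.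

Lemma lg_leBrDr x y z : (x <= y - z) = (x + z <= y).
Proof. by rewrite -[LHS](lg_leD2r z) subrK. Qed.

Lemma lg_leN2 x y : (- x <= - y) = (y <= x).
Proof. by rewrite -[LHS](lg_leD2l (x + y)) addrK addrAC subrr add0r. Qed.

Lemma lg_leNDl x y z : (- x + y <= z) = (y - z <= x).
Proof. by rewrite addrC !lg_leBlDr addrC. Qed.

Lemma lg_leBD x y z w : (x - y + z <= w) = (x + z <= w + y).
Proof. by rewrite addrAC lg_leBlDr. Qed.

Lemma lg_eqP x y : (forall w, (w <= x) = (w <= y)) -> x = y.
Proof. by move=> xy; apply: le_anti; rewrite -xy lexx xy lexx. Qed.

Lemma lg_joinE x y : lg_join x y = - lg_meet (- x) (- y).
Proof.
apply: oppr_inj; rewrite opprK; apply: lg_eqP => w.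
by rewrite lg_meetP -[w]opprK !lg_leN2 lg_joinP.
Qed.

Lemma lg_meetDr x y z : lg_meet x y + z = lg_meet (x + z) (y + z).
Proof.
by apply: lg_eqP => w; rewrite lg_meetP -!lg_leBlDr lg_meetP.
Qed.

Definition is_inf x l := forall w, (w <= x) = all (fun v => w <= v) l.

Lemma is_inf_uniq x y l : is_inf x l -> is_inf y l -> x = y.
Proof. by move=> xl yl; apply: lg_eqP => w; rewrite xl yl. Qed.

Lemma is_inf_lg_inf x l : is_inf (lg_inf x l) (x :: l).
Proof.
move=> w /=; rewrite /lg_inf; elim: l => [|y l IH];
  first by rewrite big_nil andbT.
by rewrite big_cons lg_meetP IH /= andbCA.
Qed.

Lemma is_inf_exists l : l != [::] -> exists x, is_inf x l.
Proof. by case: l => // x l _; exists (lg_inf x l); apply: is_inf_lg_inf. Qed.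

Lemma is_inf_shift x l z : is_inf x l -> is_inf (x + z) [seq v + z | v <- l].
Proof.
move=> xl w; rewrite -lg_leBlDr xl all_map; apply: eq_all => v /=.
exact: lg_leBlDr.
Qed.

Lemma is_inf_cat x y l m : is_inf x l -> is_inf y m ->
  is_inf (lg_meet x y) (l ++ m).
Proof. by move=> xl ym w; rewrite lg_meetP xl ym all_cat. Qed.

Lemma is_inf_add x y l m : is_inf x l -> is_inf y m ->
  is_inf (x + y) [seq u + v | u <- l, v <- m].
Proof.
move=> xl ym w; rewrite -lg_leBlDr xl; apply/allP/allP=> [lw|lmw u lu].
  move=> _ /allpairsP[[u v] /= [lu mv ->]].
  have /= := lw u lu; rewrite lg_leBlDr addrC -(lg_leBlDr w u y) ym =>
    /allP/(_ v mv).
  by rewrite lg_leBlDr addrC.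
rewrite /= lg_leBlDr addrC -lg_leBlDr ym; apply/allP => v mv.
by rewrite /= lg_leBlDr addrC; apply/lmw/allpairs_f.
Qed.

End LatticeGroupTheory.

Lemma lg_morphism_inf (G H : latticeGroupType) (psi : G -> H) x l :
  lg_morphism psi -> is_inf x l -> l != [::] -> is_inf (psi x) (map psi l).
Proof.
move=> [_ psi_meet _]; case: l => // y l xl _.
rewrite (is_inf_uniq xl (is_inf_lg_inf y l)) {x xl}.
have -> : psi (lg_inf y l) = lg_inf (psi y) (map psi l);
  last exact: is_inf_lg_inf.
rewrite /lg_inf big_map; elim: l => [|z l IH]; first by rewrite !big_nil.
by rewrite !big_cons psi_meet IH.
Qed.

(** * Divisors as infima of fractions *)

Section DivisorGroup.
Variables (R : idomainType) (G : latticeGroupType) (div : {fraction R} -> G).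
Hypothesis is_div_R : is_div div.
Implicit Types (a b c : R) (s t : seq R) (x y w : G).

Definition rdiv a : G := div (tofrac a).

Lemma rdivM a b : a != 0 -> b != 0 -> rdiv (a * b) = rdiv a + rdiv b.
Proof.
move=> nz_a nz_b; rewrite /rdiv rmorphM.
by rewrite (div_mul is_div_R) // tofrac_eq0.
Qed.

Lemma rdiv1 : rdiv 1 = 0.
Proof. by apply: (addrI (rdiv 1)); rewrite -rdivM ?oner_eq0 // mulr1 addr0. Qed.

Lemma rdiv_quotient a b : a != 0 -> b != 0 ->
  div (tofrac a / tofrac b) + rdiv b = rdiv a.
Proof.
move=> nz_a nz_b; have nz_tb : tofrac b != 0 by rewrite tofrac_eq0.
rewrite -(div_mul is_div_R) ?divfK // mulf_neq0 ?invr_eq0 //.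
by rewrite tofrac_eq0.
Qed.

Lemma rdiv_le a b : a != 0 -> b != 0 -> rdiv a <= rdiv b <-> rdivides a b.
Proof.
move=> nz_a nz_b; have nz_ta : tofrac a != 0 by rewrite tofrac_eq0.
rewrite -(rdiv_quotient nz_b nz_a) -{1}[rdiv a]add0r lg_leD2r.
rewrite (div_ge0 is_div_R) ?mulf_neq0 ?invr_eq0 ?tofrac_eq0 //.
split=> -[c E]; exists c.
  by apply: tofrac_inj; rewrite tofracM -E mulrCA mulfV ?mulr1.
by rewrite E tofracM mulrAC mulfV ?mul1r.
Qed.

(* [x] is the divisor of the fractional ideal generated by the [c / a] for    *)
(* [c] in [s].                                                                *)
Definition ideal_divisor s a x :=
  [/\ s != [::], {in s, forall c, c != 0}, a != 0 &
      is_inf (x + rdiv a) (map rdiv s)].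

Lemma common_denominator (l : seq {fraction R}) : {in l, forall q, q != 0} ->
  exists a s, [/\ a != 0, {in s, forall c, c != 0} &
    map rdiv s = [seq div q + rdiv a | q <- l]].
Proof.
elim: l => [|y l IH] nz_l; first by exists 1, [::]; rewrite oner_eq0.
have [|a [s [nz_a nz_s sE]]] := IH; first by move=> z lz; apply: nz_l;
  rewrite inE lz orbT.
have [u [v [nz_v yE]]] := fraction_quotient y.
have nz_u : u != 0.
  apply: contraNneq (nz_l y (mem_head _ _)) => u0.
  by rewrite yE u0 rmorph0 mul0r.
exists (v * a), (u * a :: map ( *%R v) s); split; first by rewrite mulf_neq0.
  move=> c; rewrite inE => /predU1P[->|/mapP[e se ->]]; rewrite mulf_neq0 //.
  exact: nz_s.
rewrite /= rdivM // -(rdiv_quotient nz_u nz_v) -yE rdivM // addrA;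
  congr (_ :: _).
have -> : [seq div z + (rdiv v + rdiv a) | z <- l] =
    [seq rdiv v + x | x <- map rdiv s].
  by rewrite sE -map_comp; apply: eq_map => z /=; rewrite addrCA.
rewrite -!map_comp; apply/eq_in_map => c sc /=.
by rewrite rdivM // nz_s.
Qed.

Lemma ideal_divisor_exists x : exists s a, ideal_divisor s a x.
Proof.
have [y [l [nz_y nz_l xE]]] := div_inf is_div_R x.
have [|a [s [nz_a nz_s sE]]] := @common_denominator (y :: l).
  by move=> z; rewrite inE => /predU1P[->|/nz_l].
exists s, a; split=> //; first by case: s sE {nz_s}.
have -> : map rdiv s = [seq v + rdiv a | v <- map div (y :: l)].
  by rewrite sE -map_comp.
by rewrite xE; apply: is_inf_shift; apply: is_inf_lg_inf.
Qed.

Lemma ideal_divisor_of s a :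
  s != [::] -> {in s, forall c, c != 0} -> a != 0 ->
    exists x, ideal_divisor s a x.
Proof.
move=> s0 nz_s nz_a.
have [|x xs] := @is_inf_exists _ (map rdiv s); first by case: s s0 {nz_s}.
by exists (x - rdiv a); split; rewrite ?subrK.
Qed.

Lemma ideal_divisor_rdiv a : a != 0 -> ideal_divisor [:: a] 1 (rdiv a).
Proof.
move=> nz_a; split; rewrite ?oner_eq0 //; first by move=> c /[!inE]/eqP->.
by rewrite rdiv1 addr0 => w; rewrite /= andbT.
Qed.

Lemma ideal_divisor_add s a x t b y :
  ideal_divisor s a x -> ideal_divisor t b y ->
  ideal_divisor [seq c * e | c <- s, e <- t] (a * b) (x + y).
Proof.
move=> [s0 nz_s nz_a xs] [t0 nz_t nz_b yt]; split.
- by rewrite allpairs_eq0 negb_or s0.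
- by move=> _ /allpairsP[[c e] /= [sc te ->]];
  rewrite mulf_neq0 ?(nz_s c) ?(nz_t e).
- by rewrite mulf_neq0.
rewrite rdivM // addrACA.
have -> : map rdiv [seq c * e | c <- s, e <- t] =
    [seq u + v | u <- map rdiv s, v <- map rdiv t].
  rewrite map_allpairs allpairs_mapl allpairs_mapr.
  by apply/eq_in_allpairs => c e sc te; rewrite /= rdivM ?(nz_s c) ?(nz_t e).
exact: is_inf_add.
Qed.

Lemma ideal_divisor_meet s a x t b y :
  ideal_divisor s a x -> ideal_divisor t b y ->
  ideal_divisor (map ( *%R b) s ++ map ( *%R a) t) (a * b) (lg_meet x y).
Proof.
have mapE u r : u != 0 -> {in r, forall c, c != 0} ->
    map rdiv (map ( *%R u) r) = [seq v + rdiv u | v <- map rdiv r].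
  move=> nz_u nz_r; rewrite -!map_comp; apply/eq_in_map => c rc /=.
  by rewrite rdivM ?(nz_r c) // addrC.
move=> [s0 nz_s nz_a xs] [t0 nz_t nz_b yt]; split.
- by case: s s0 {nz_s xs}.
- move=> c; rewrite mem_cat => /orP[] /mapP[e re ->]; rewrite mulf_neq0 //.
    exact: nz_s.
  exact: nz_t.
- by rewrite mulf_neq0.
rewrite map_cat !mapE // lg_meetDr rdivM //.
rewrite addrA [rdiv a + _]addrC [y + _]addrA.
by apply: is_inf_cat; apply: is_inf_shift.
Qed.

(** A test fraction [u / h] for the divisorial closure is a principal lower bound of [x], up to the
    denominators; the converse needs such principal bounds to determine [x]. *)
Lemma ideal_divisor_le s a x t b y :
  ideal_divisor s a x -> ideal_divisor t b y ->
  x <= y <-> {in t, forall c, vdivides (map ( *%R b) s) (a * c)}.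
Proof.
move=> [s0 nz_s nz_a xs] [t0 nz_t nz_b yt];
  split=> [le_xy c tc u h nz_h hu|vst].
  have [->|nz_u] := eqVneq u 0; first by exists 0; rewrite mul0r mulr0.
  apply/rdiv_le; rewrite ?mulf_neq0 ?(nz_t c) //.
  have: rdiv h - rdiv (u * b) <= x + rdiv a.
    rewrite xs; apply/allP => _ /mapP[e se ->].
    rewrite lg_leBlDr -rdivM ?mulf_neq0 ?(nz_s e) //.
    apply/rdiv_le; rewrite ?mulf_neq0 ?(nz_s e) //.
    by rewrite mulrC -mulrA; apply/hu/map_f.
  rewrite -lg_leBlDr => /le_trans/(_ le_xy).
  rewrite -[X in is_true X -> _](lg_leD2r (rdiv b)) yt =>
    /allP/(_ _ (map_f _ tc)).
  rewrite -[X in is_true X -> _](lg_leD2r (rdiv (u * a))) !rdivM ?mulf_neq0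
    ?(nz_t c) //.
  rewrite [rdiv u + rdiv a]addrC addrA (addrAC _ (rdiv b) (rdiv a)) subrK.
  rewrite -addrA [rdiv b + _]addrC subrK => /le_trans; apply.
  by rewrite addrA [rdiv c + _ + _]addrC [rdiv c + _]addrC addrA.
(* As [- x] is an infimum of fractions [c' / a'], [x] is the supremum of the principal divisors of
   the [a' / c']. *)
have [t' [a' [t'0 nz_t' nz_a' xt']]] := ideal_divisor_exists (- x).
rewrite -lg_leN2 -(lg_leD2r (rdiv a')) xt'; apply/allP => _ /mapP[c' tc' ->].
rewrite lg_leNDl -(lg_leD2r (rdiv b)) yt; apply/allP => _ /mapP[c tc ->].
have nz_c' : c' != 0 by rewrite nz_t'.
have nz_c : c != 0 by rewrite nz_t.
rewrite lg_leBD -!rdivM //; apply/rdiv_le; rewrite ?mulf_neq0 //.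
apply/(rdividesM2l _ _ nz_a).
have -> : a * (c * c') = c' * (a * c) by ring.
apply: vst => //; first by rewrite !mulf_neq0.
move=> _ /mapP[e se ->]; 
have nz_e : e != 0 by rewrite nz_s.
have -> : a * (a' * b) = b * (a' * a) by ring.
have -> : c' * (b * e) = b * (e * c') by ring.
apply/(rdividesM2l _ _ nz_b)/rdiv_le; rewrite ?mulf_neq0 //.
rewrite !rdivM // -lg_leBD; have := lexx (x + rdiv a).
rewrite [X in is_true X -> _]xs => /allP/(_ _ (map_f _ se)); apply: le_trans.
rewrite lg_leD2r -lg_leNDl; have := lexx (- x + rdiv a').
by rewrite [X in is_true X -> _]xt' => /allP/(_ _ (map_f _ tc')).
Qed.

End DivisorGroup.

Lemma lg_morphism_add_meet (G H : latticeGroupType) (phi : G -> H) :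
  {morph phi : x y / x + y} -> {morph phi : x y / lg_meet x y} ->
  lg_morphism phi.
Proof.
move=> phiD phi_meet.
have phi0 : phi 0 = 0 by apply: (addrI (phi 0)); rewrite -phiD !addr0.
have phiN x : phi (- x) = - phi x.
  by apply: (addrI (phi x)); rewrite -phiD !subrr.
split=> // [x y|x y]; first by rewrite phiD phiN.
by rewrite !lg_joinE phiN phi_meet !phiN.
Qed.

(** * The morphism between the divisor groups *)

Section DivisorExtension.
Variables (A : idomainType) (L : fieldType).
Variable iota : {rmorphism {fraction A} -> L}.
Hypothesis pvmd_A : ring_with_divisors A.
Local Notation f := (frac_restrict iota).
Local Notation B := (integral_closure f).
Local Notation base := (integral_base f).
Variables (DivA DivB : latticeGroupType).
Variables (divA : {fraction A} -> DivA) (divB : {fraction B} -> DivB).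
Hypotheses (is_divA : is_div divA) (is_divB : is_div divB).

Lemma map_base_mul u (r : seq A) :
  map ( *%R (base u)) (map base r) = map base (map ( *%R u) r).
Proof. by rewrite -!map_comp; apply: eq_map => c /=; rewrite rmorphM. Qed.

(** The graph of [phi], free of any choice of generators. *)
Definition same_ideal_divisor x y := exists s a,
  ideal_divisor divA s a x /\ ideal_divisor divB (map base s) (base a) y.

(** Both orders are the same [vdivides] statement. This one equality yields that the relation is
    functional and that [phi] is injective. *)
Lemma same_ideal_divisor_le x y x' y' :
  same_ideal_divisor x y -> same_ideal_divisor x' y' -> (x <= x') = (y <= y').
Proof.
move=> [s [a [sx sy]]] [t [b [tx ty]]].
have [s0 nz_s nz_a _] := sx; have [t0 nz_t nz_b _] := tx.
have bs_nz : {in map ( *%R b) s, forall e, e != 0}.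
  by move=> _ /mapP[e se ->]; rewrite mulf_neq0 // nz_s.
have bs0 : map ( *%R b) s != [::] by case: s s0 {nz_s sx sy bs_nz}.
have vE c := vdivides_integral_base iota pvmd_A (a * c) bs0 bs_nz.
apply/idP/idP.
  move/(ideal_divisor_le is_divA sx tx) => vst.
  apply/(ideal_divisor_le is_divB sy ty) => _ /mapP[c tc ->].
  by rewrite map_base_mul -rmorphM; apply/vE/vst.
move/(ideal_divisor_le is_divB sy ty) => vst.
apply/(ideal_divisor_le is_divA sx tx) => c tc.
by apply/vE; rewrite -map_base_mul rmorphM; apply/vst/map_f.
Qed.

Lemma same_ideal_divisor_fun x y y' :
  same_ideal_divisor x y -> same_ideal_divisor x y' -> y = y'.
Proof.
by move=> xy xy'; apply: le_anti; rewrite -(same_ideal_divisor_le xy xy')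
  -(same_ideal_divisor_le xy' xy) lexx.
Qed.

Lemma map_base_neq0 (s : seq A) : {in s, forall c, c != 0} ->
  {in map base s, forall c, c != 0}.
Proof. by move=> nz_s _ /mapP[c sc ->]; rewrite integral_base_eq0 nz_s. Qed.

Lemma same_ideal_divisor_total x : exists y, same_ideal_divisor x y.
Proof.
have [s [a sx]] := ideal_divisor_exists is_divA x; have [s0 nz_s nz_a _] := sx.
have [||| y sy] := @ideal_divisor_of B DivB divB (map base s) (base a).
- by case: s s0 {nz_s sx}.
- exact: map_base_neq0.
- by rewrite integral_base_eq0.
by exists y, s, a.
Qed.

Lemma same_ideal_divisor_rdiv a : a != 0 ->
  same_ideal_divisor (rdiv divA a) (rdiv divB (base a)).
Proof.
move=> nz_a; exists [:: a], 1; split; first exact: ideal_divisor_rdiv.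
rewrite rmorph1; apply: (ideal_divisor_rdiv is_divB).
by rewrite integral_base_eq0.
Qed.

Lemma same_ideal_divisor_add x y x' y' :
  same_ideal_divisor x y -> same_ideal_divisor x' y' ->
  same_ideal_divisor (x + x') (y + y').
Proof.
move=> [s [a [sx sy]]] [t [b [tx ty]]].
exists [seq c * e | c <- s, e <- t], (a * b).
split; first exact: ideal_divisor_add.
have := ideal_divisor_add is_divB sy ty.
rewrite -rmorphM map_allpairs allpairs_mapl allpairs_mapr.
have -> // : [seq base c * base e | c <- s, e <- t] =
    [seq base (c * e) | c <- s, e <- t].
by apply: eq_allpairs => c e; rewrite rmorphM.
Qed.

Lemma same_ideal_divisor_meet x y x' y' :
  same_ideal_divisor x y -> same_ideal_divisor x' y' ->
  same_ideal_divisor (lg_meet x x') (lg_meet y y').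
Proof.
move=> [s [a [sx sy]]] [t [b [tx ty]]].
exists (map ( *%R b) s ++ map ( *%R a) t), (a * b).
split; first exact: ideal_divisor_meet.
have := ideal_divisor_meet is_divB sy ty.
by rewrite !map_base_mul -map_cat rmorphM.
Qed.

(** A morphism preserves finite infima, so its values on principal divisors determine it. *)
Lemma same_ideal_divisor_morphism (psi : DivA -> DivB) x : lg_morphism psi ->
  (forall a, a != 0 -> psi (divA (tofrac a)) = divB (tofrac (base a))) ->
  same_ideal_divisor x (psi x).
Proof.
move=> mpsi psiE; have [s [a sx]] := ideal_divisor_exists is_divA x.
exists s, a; split=> //; have [s0 nz_s nz_a xs] := sx; split.
- by case: s s0 {nz_s sx xs}.
- exact: map_base_neq0.
- by rewrite integral_base_eq0.
have s0' : map (rdiv divA) s != [::] by case: s s0 {nz_s sx xs}.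
have := lg_morphism_inf mpsi xs s0'.
have -> : map psi (map (rdiv divA) s) = map (rdiv divB) (map base s).
  by rewrite -!map_comp; apply/eq_in_map => c sc; apply/psiE/nz_s.
have -> // : psi (x + rdiv divA a) = psi x + rdiv divB (base a).
have [psiB _ _] := mpsi.
have := psiB (x + rdiv divA a) (rdiv divA a).
by rewrite addrK => ->; rewrite [psi (rdiv _ _)]psiE // subrK.
Qed.

Lemma div_extension : exists phi : DivA -> DivB,
  [/\ lg_morphism phi,
      forall a, a != 0 -> phi (divA (tofrac a)) = divB (tofrac (base a)),
      forall psi : DivA -> DivB, lg_morphism psi ->
        (forall a, a != 0 -> psi (divA (tofrac a)) = divB (tofrac (base a))) ->
        psi =1 phi &
      injective phi].
Proof.
have [phi phiP] := choice same_ideal_divisor_total.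
have phi_uniq x y : same_ideal_divisor x y -> y = phi x.
  by move=> xy; apply: same_ideal_divisor_fun xy (phiP x).
exists phi; split=> [|a nz_a|psi mpsi psiE x|x y phi_xy].
- apply: lg_morphism_add_meet => x y; apply/esym/phi_uniq.
    exact: same_ideal_divisor_add.
  exact: same_ideal_divisor_meet.
- exact/esym/phi_uniq/same_ideal_divisor_rdiv.
- exact/phi_uniq/same_ideal_divisor_morphism.
by apply: le_anti; rewrite !(same_ideal_divisor_le (phiP _) (phiP _)) phi_xy
  lexx.
Qed.

End DivisorExtension.

(** * Absolute values and disjointness *)

Section LatticeGroupAbs.
Variable G : latticeGroupType.
Implicit Types (x y z w : G).

Lemma lg_abs_le x z : (lg_abs x <= z) = (x <= z) && (- x <= z).
Proof. exact: lg_joinP. Qed.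

Lemma lg_le_abs x : x <= lg_abs x.
Proof. by have := lexx (lg_abs x); rewrite lg_abs_le => /andP[]. Qed.

Lemma lg_leN_abs x : - x <= lg_abs x.
Proof. by have := lexx (lg_abs x); rewrite lg_abs_le => /andP[]. Qed.

Lemma lg_absN x : lg_abs (- x) = lg_abs x.
Proof.
have := lg_leN_abs (- x); rewrite opprK => le_x.
apply: le_anti; rewrite [lg_abs (- x) <= _]lg_abs_le opprK lg_leN_abs lg_le_abs
  /=.
by rewrite lg_abs_le le_x lg_le_abs.
Qed.

(* With [y] the meet of [x] and [0], [0 <= x + x] yields [y + y = y].         *)
Lemma lg_ge0_double x : 0 <= x + x -> 0 <= x.
Proof.
move=> ge0_xx; set y := lg_meet x 0.
have yP w : (w <= y) = (w <= x) && (w <= 0) by apply: lg_meetP.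
suff y0 : y = 0 by have := lexx y; rewrite {2}/y lg_meetP y0 => /andP[].
have le_y : y <= y + y.
  rewrite lg_meetDr lg_meetP add0r lexx andbT [x + y]addrC lg_meetDr lg_meetP
    add0r.
  have := lexx y; rewrite {2}/y lg_meetP => /andP[-> /le_trans-> //].
apply: le_anti; have := lexx y; rewrite {2}/y lg_meetP => /andP[_ ->] /=.
by rewrite -(lg_leD2l y) addr0.
Qed.

Lemma lg_abs_ge0 x : 0 <= lg_abs x.
Proof.
apply: lg_ge0_double; rewrite -(subrr x).
by apply: lg_leD; rewrite ?lg_le_abs ?lg_leN_abs.
Qed.

Lemma lg_leMn x y n : x <= y -> x *+ n <= y *+ n.
Proof.
move=> le_xy; elim: n => [|n IH]; first by rewrite !mulr0n.
by rewrite !mulrSr lg_leD.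
Qed.

Lemma lg_leMnr x m n : 0 <= x -> (m <= n)%N -> x *+ m <= x *+ n.
Proof.
move=> ge0_x le_mn; rewrite -(subnK le_mn) mulrnDr -{1}[x *+ m]add0r lg_leD2r.
by rewrite -(mul0rn G (n - m)) lg_leMn.
Qed.

Lemma lg_absMn x n : lg_abs (x *+ n) <= lg_abs x *+ n.
Proof.
by rewrite lg_abs_le -mulNrn !lg_leMn ?lg_le_abs ?lg_leN_abs.
Qed.

(* The additive counterpart of [vdivides_exp], by the same replacement.       *)
Lemma lg_disjointMn (W : seq G) N :
  {in W, forall w, 0 <= w} ->
  (forall z, {in W, forall w, z <= w} -> z <= 0) ->
  forall z, {in W, forall w, z <= w *+ N} -> z <= 0.
Proof.
move=> ge0_W infW.
suff: forall V, {in V, forall w, 0 <= w} ->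
    (forall z, {in W ++ V, forall w, z <= w} -> z <= 0) ->
    forall z, {in W, forall w, z <= w *+ N} -> {in V, forall w, z <= w} ->
      z <= 0.
  by move=> /(_ [::]) H z zW; apply: H => //; rewrite cats0.
elim: W ge0_W {infW} => [|w W IH] ge0_W V ge0_V infV z zW zV; first exact: infV.
have ge0_w : 0 <= w by rewrite ge0_W ?mem_head.
have K y : {in W, forall v, y <= v *+ N} -> {in w :: V, forall v, y <= v} ->
  y <= 0.
  apply: IH => [v Wv|v|{}y Wy]; first by rewrite ge0_W // inE Wv orbT.
    by rewrite inE => /predU1P[->|/ge0_V].
  apply: infV => v Wv; apply: Wy; move: Wv.
  by rewrite !mem_cat !inE orbCA orbA.
have := zW w (mem_head _ _); elim: (N in w *+ N) => [|M IHM];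
  first by rewrite mulr0n.
move=> zM; apply: IHM; rewrite -[_ *+ _]add0r -lg_leBlDr; apply: K => [v Wv|v].
  rewrite lg_leBlDr; apply: (le_trans (zW v _)); first by rewrite inE Wv orbT.
  by rewrite -[leLHS]addr0 lg_leD2l -(mul0rn G M) lg_leMn.
rewrite lg_leBlDr inE => /predU1P[->|Vv]; first by rewrite -mulrS.
apply: (le_trans (zV v Vv)).
by rewrite -[leLHS]addr0 lg_leD2l -(mul0rn G M) lg_leMn.
Qed.

(* The counterpart in lattice groups of the fact that the minimal valuation   *)
(* among terms of sum zero is attained twice.                                 *)
Lemma lg_abs_differences (I : eqType) (r : seq I) (u : I -> G) :
  r != [::] ->
  (forall i w, i \in r -> {in r, forall j, j != i -> w <= u j} -> w <= u i) ->
  forall z, {in r &, forall i j, i != j -> z <= lg_abs (u i - u j)} -> z <= 0.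
Proof.
move=> r0 u_dom z zr.
have [|m mP] := @is_inf_exists _ (map u r); first by case: r r0 {u_dom zr}.
have le_m i : i \in r -> m <= u i.
  move=> ri; have := lexx m.
  by rewrite [X in is_true X -> _]mP => /allP/(_ _ (map_f u ri)).
(* Each of [u i] and [u j] is at least [m], so subtracting one costs no more than adding it and
   removing [m] twice. *)
have abs_le i j : i \in r -> j \in r ->
  lg_abs (u i - u j) <= u i + u j - (m + m).
  move=> ri rj; have half k l : l \in r -> u k - u l <= u k + u l - (m + m).
    by move=> rl; rewrite lg_leBrDr lg_leBD -addrA lg_leD2l lg_leD ?le_m.
  by rewrite lg_abs_le half // opprB addrC [u i + u j]addrC addrC half.
suff: z + m <= m by rewrite -{2}[m]add0r lg_leD2r.
rewrite mP; apply/allP => _ /mapP[i ri ->].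
(* The left side is below [u j] for each [j != i], hence below [u i] too by [u_dom]. *)
have: z + (m + m) - u i <= m.
  have zj j : j \in r -> j != i -> z + (m + m) - u i <= u j.
    move=> rj ne_ji; rewrite lg_leBlDr -lg_leBrDr.
    by apply: le_trans (abs_le j i rj ri); apply: zr.
  rewrite mP; apply/allP => _ /mapP[j rj ->].
  have [->|ne_ji] := eqVneq j i; last exact: zj.
  by apply: u_dom => // k rk; apply: zj.
by rewrite lg_leBlDr addrA [m + u i]addrC lg_leD2r.
Qed.

End LatticeGroupAbs.

Section IntSpan.
Variables (V : zmodType) (m : nat) (s : m.-tuple V).

Lemma inIntSpan_mem v : v \in s -> inIntSpan s v.
Proof.
case/(nthP 0) => i; rewrite size_tuple => lt_im <-.
exists [ffun j : 'I_m => (j == Ordinal lt_im)%:Z].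
rewrite (bigD1 (Ordinal lt_im)) //= ffunE eqxx mulr1z big1 ?addr0 // => j.
by rewrite ffunE => /negPf->; rewrite mulr0z.
Qed.

Lemma inIntSpan_sub v w : inIntSpan s v -> inIntSpan s w -> inIntSpan s (v - w).
Proof.
move=> [a ->] [b ->]; exists (a - b); rewrite -sumrB; apply: eq_bigr => i _.
by rewrite !ffunE mulrzBr.
Qed.

Lemma inIntSpan_mulrn v n : inIntSpan s v -> inIntSpan s (v *+ n).
Proof.
move=> [a ->]; exists (a *+ n); rewrite -sumrMnl; apply: eq_bigr => i _.
by rewrite ffunMnE pmulrn -mulrzA pmulrn mulrzz.
Qed.

End IntSpan.

(** The ultrametric inequality: the sum lies in the ideal generated by [s], hence in its divisorial
    closure. *)
Lemma rdiv_sum_ge (R : idomainType) (G : latticeGroupType)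
    (div : {fraction R} -> G) (hd : is_div div) (s : seq R) w :
  {in s, forall c, c != 0} -> \sum_(c <- s) c != 0 ->
  {in s, forall c, w <= rdiv div c} -> w <= rdiv div (\sum_(c <- s) c).
Proof.
move=> nz_s nz_sum ws.
have s0 : s != [::] by apply: contraNneq nz_sum => ->; rewrite big_nil.
have [x sx] := ideal_divisor_of div s0 nz_s (oner_neq0 R).
apply: (@le_trans _ _ x).
  have [_ _ _ xs] := sx; rewrite -[x]addr0 -(rdiv1 hd) xs.
  by apply/allP => _ /mapP[c sc ->]; apply: ws.
apply/(ideal_divisor_le hd sx (ideal_divisor_rdiv hd nz_sum)) => c.
rewrite inE => /eqP-> x' h nz_h hx; rewrite mul1r big_distrr /= big_seq.
by apply: rdivides_sum => e se; rewrite -[e]mul1r; apply/hx/map_f.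
Qed.

Lemma dvdn_lcm_iota d k : (0 < k <= d)%N ->
  (k %| \big[lcmn/1]_(1 <= i < d.+1) i)%N.
Proof.
move=> kd; rewrite (bigD1_seq k) ?iota_uniq ?dvdn_lcml //.
by rewrite mem_index_iota ltnS.
Qed.

(** * Slopes of the equation of an integral element *)

Section IntegralElement.
Variables (A : idomainType) (L : fieldType).
Variable iota : {rmorphism {fraction A} -> L}.
Local Notation f := (frac_restrict iota).
Local Notation B := (integral_closure f).
Local Notation base := (integral_base f).
Variables (DivA DivB : latticeGroupType).
Variables (divA : {fraction A} -> DivA) (divB : {fraction B} -> DivB).
Hypothesis is_divB : is_div divB.
Variables (phi : DivA -> DivB) (x : B) (p : {poly A}) (d : nat).
Hypothesis phi_morphism : lg_morphism phi.
Hypothesis phiE : forall a, a != 0 ->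
  phi (divA (tofrac a)) = divB (tofrac (base a)).
Hypotheses (nz_x : x != 0) (size_p : size p = d.+1).
Hypothesis root_p : root (map_poly f p) (val x).

Local Notation D := (\big[lcmn/1]_(1 <= i < d.+1) i)%N.
Local Notation xi := (rdiv divB x).

Definition coef_support := [seq i <- index_iota 0 (size p) | p`_i != 0].

Definition term_divisor i := rdiv divB (base p`_i) + xi *+ i.

Lemma rdivX (n : nat) : rdiv divB (x ^+ n) = xi *+ n.
Proof.
elim: n => [|n IH]; first by rewrite expr0 mulr0n (rdiv1 is_divB).
by rewrite exprS mulrS (rdivM is_divB) ?expf_neq0 // IH.
Qed.

Lemma mem_coef_support i : i \in coef_support -> p`_i != 0.
Proof. by rewrite mem_filter => /andP[]. Qed.

Lemma term_neq0 i : i \in coef_support -> base p`_i * x ^+ i != 0.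
Proof.
by move=> pi; rewrite mulf_neq0 ?expf_neq0 // integral_base_eq0
  mem_coef_support.
Qed.

Lemma rdiv_term i : i \in coef_support ->
  rdiv divB (base p`_i * x ^+ i) = term_divisor i.
Proof.
move=> pi; rewrite (rdivM is_divB) ?rdivX ?expf_neq0 //.
by rewrite integral_base_eq0 mem_coef_support.
Qed.

Lemma sum_terms : \sum_(i <- coef_support) base p`_i * x ^+ i = 0.
Proof.
rewrite big_filter big_mkcond /=.
have -> : \sum_(i <- index_iota 0 (size p))
    (if p`_i != 0 then base p`_i * x ^+ i else 0) =
    \sum_(0 <= i < size p) base p`_i * x ^+ i.
  apply: eq_bigr => i _; case: eqP => // ->.
  by rewrite rmorph0 mul0r.
apply: val_inj; rewrite (rmorph_sum (val : B -> L)).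
rewrite [RHS](rmorph0 (val : B -> L)).
have /rootP := root_p; rewrite horner_coef size_map_poly_id0; last first.
  by rewrite frac_restrict_eq0 lead_coef_eq0 -size_poly_eq0 size_p.
move=> sum0; rewrite -[RHS]sum0 big_mkord; apply: eq_bigr => i _.
rewrite coef_map; apply: etrans (integral_valM _ _) _.
by rewrite [val (x ^+ i)](rmorphXn (val : B -> L)).
Qed.

(** The [i]-th term of the equation is minus the sum of the others, so [rdiv_sum_ge] applies. *)
Lemma term_divisor_dominates i w : i \in coef_support ->
  {in coef_support, forall j, j != i -> w <= term_divisor j} ->
    w <= term_divisor i.
Proof.
move=> pi wj; have uniq_supp : uniq coef_support by rewrite filter_uniq
  ?iota_uniq.
have := sum_terms; rewrite (bigD1_seq i) //= => /eqP;
  rewrite addr_eq0 => /eqP sumE.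
pose s := [seq - (base p`_j * x ^+ j) | j <- coef_support & j != i].
have sE : \sum_(c <- s) c = base p`_i * x ^+ i.
  by rewrite big_map big_filter sumrN -sumE.
rewrite -rdiv_term // -sE; apply: (rdiv_sum_ge is_divB).
- move=> _ /mapP[j + ->]; rewrite mem_filter => /andP[_ pj].
  by rewrite oppr_eq0 term_neq0.
- by rewrite sE term_neq0.
move=> _ /mapP[j + ->]; rewrite mem_filter => /andP[ne_ji pj].
apply: (le_trans (wj j pj ne_ji)); rewrite -rdiv_term //.
apply/(rdiv_le is_divB); rewrite ?oppr_eq0 ?term_neq0 //.
by exists (- 1); rewrite mulrN1.
Qed.

(** A single nonzero term could not vanish at [x != 0]. This makes the final infimum one over a
    nonempty family. *)
Lemma coef_support_pair :
  exists i j, [/\ i \in coef_support, j \in coef_support & (i < j)%N].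
Proof.
have pd : d \in coef_support.
  rewrite mem_filter mem_index_iota size_p ltnSn andbT.
  by rewrite -[d]/(d.+1.-1) -size_p -lead_coefE lead_coef_eq0 -size_poly_eq0
    size_p.
have [/hasP[j pj ne_jd]|/hasPn all_d] :=
  boolP (has (fun j => j != d) coef_support).
  exists j, d; split=> //; rewrite ltn_neqAle ne_jd.
  by move: pj; rewrite mem_filter mem_index_iota size_p => /andP[_].
have := term_neq0 pd; have := sum_terms.
rewrite (bigD1_seq d) //= ?filter_uniq ?iota_uniq // big_seq_cond big1 ?addr0.
  by move=> ->; rewrite eqxx.
by move=> j /andP[/all_d /negPn/eqP->]; rewrite eqxx.
Qed.

(** [D] times the slope: equality of the [i]-th and [j]-th term divisors means that [(j - i) xi] is
    the difference of the coefficient divisors. The pairs used have [i < j <= d], so the division is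
    exact. *)
Definition coef_gamma i j : DivA :=
  (rdiv divA p`_i - rdiv divA p`_j) *+ (D %/ (j - i)).

Lemma lcm_sub_coef_gamma i j : i \in coef_support -> j \in coef_support ->
  (i < j)%N ->
  xi *+ D - phi (coef_gamma i j) =
  (term_divisor j - term_divisor i) *+ (D %/ (j - i)).
Proof.
move=> pi pj lt_ij; have [phiB _ _] := phi_morphism.
have phi0 : phi 0 = 0 by rewrite -(subrr 0) phiB subrr.
have phiMn y n : phi (y *+ n) = phi y *+ n.
  elim: n => [|n IH]; first by rewrite !mulr0n.
  have -> : y *+ n.+1 = y - (0 - y *+ n) by rewrite sub0r opprK mulrS.
  by rewrite !phiB phi0 sub0r opprK IH mulrS.
have dvd_D : (j - i %| D)%N.
  apply: dvdn_lcm_iota; rewrite subn_gt0 lt_ij leq_subLR.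
  move: pj; rewrite mem_filter mem_index_iota size_p ltnS => /andP[_ /andP[_]].
  by move/leq_trans; apply; rewrite leq_addl.
rewrite -{1}(divnK dvd_D) mulnC mulrnA phiMn phiB !phiE ?mem_coef_support //.
rewrite -mulrnBl /term_divisor; congr (_ *+ _).
have -> : xi *+ j = xi *+ (j - i) + xi *+ i by rewrite -mulrnDr subnK // ltnW.
rewrite opprB [rdiv _ (base p`_i) + _]addrC [in RHS]addrA addrKA addrA.
by rewrite [_ + xi *+ _]addrC.
Qed.

Lemma inf_abs_lcm_sub_coef_gamma : exists g gs,
  {in g :: gs, forall y, exists i j,
    [/\ i \in coef_support, j \in coef_support, (i < j)%N &
      y = coef_gamma i j]} /\
  lg_inf (lg_abs (xi *+ D - phi g)) [seq lg_abs (xi *+ D - phi y) | y <- gs] =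
    0.
Proof.
have [i0 [j0 [pi0 pj0 lt_ij0]]] := coef_support_pair.
pose P := [seq (i, j) | i <- coef_support, j <- coef_support].
pose Q := [seq ij <- P | (ij.1 < ij.2)%N].
have memQ i j : (i, j) \in Q =
    [&& (i < j)%N, i \in coef_support & j \in coef_support].
  rewrite mem_filter; congr (_ && _).
  apply/allpairsP/andP=> [[[k l] /= [pk pl [-> ->]]]|[pi pj]] //.
  by exists (i, j).
have Qij0 : (i0, j0) \in Q by rewrite memQ lt_ij0 pi0.
pose w ij := lg_abs (term_divisor ij.1 - term_divisor ij.2).
pose delta ij := lg_abs (xi *+ D - phi (coef_gamma ij.1 ij.2)).
have infw z : {in map w Q, forall v, z <= v} -> z <= 0.
  move=> zw; apply: (@lg_abs_differences DivB _ coef_support term_divisor) =>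
    //.
  - by apply: contraTneq pi0 => ->.
  - by move=> i v; apply: term_divisor_dominates.
  move=> i j pi pj; rewrite neq_ltn => /orP[] lt_ij.
    by apply: zw; apply/mapP; exists (i, j); rewrite // memQ lt_ij pi.
  rewrite -lg_absN opprB.
  by apply: zw; apply/mapP; exists (j, i); rewrite // memQ lt_ij pj.
have infd : is_inf 0 (map delta Q).
  move=> z; apply/idP/allP => [z0 _ /mapP[ij _ ->]|zd].
    exact: le_trans z0 (lg_abs_ge0 _).
  (* Each [delta] is at most [D] times the corresponding [w], whose infimum is zero. *)
  apply: (@lg_disjointMn _ (map w Q) D _ infw) => [_ /mapP[ij _ ->]|].
    exact: lg_abs_ge0.
  move=> _ /mapP[[i j] Qij ->]; apply: (le_trans (zd _ (map_f delta Qij))).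
  move: Qij; rewrite memQ => /and3P[lt_ij pi pj].
  rewrite /delta /w /= lcm_sub_coef_gamma // -[lg_abs (_ i - _)]lg_absN opprB.
  apply: (le_trans (lg_absMn _ _)).
  by apply: lg_leMnr; [apply: lg_abs_ge0 | apply: leq_div].
case defQ: Q => [|[i1 j1] Q'] in memQ Qij0 infd *; first by [].
exists (coef_gamma i1 j1), [seq coef_gamma ij.1 ij.2 | ij <- Q']; split.
  have -> : coef_gamma i1 j1 :: [seq coef_gamma ij.1 ij.2 | ij <- Q'] =
    [seq coef_gamma ij.1 ij.2 | ij <- (i1, j1) :: Q'] by [].
  move=> _ /mapP[[i j] Qij ->]; exists i, j.
  by move: Qij; rewrite memQ => /and3P[].
by rewrite -map_comp; apply: is_inf_uniq infd; apply: is_inf_lg_inf.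
Qed.

End IntegralElement.

Theorem mainTheorem13 (A : idomainType) (L : fieldType)
    (iota : {rmorphism {fraction A} -> L}) :
  let f := frac_restrict iota in
  let B := integral_closure f in
  ring_with_divisors A ->
  ring_with_divisors B /\
  forall (DivA DivB : latticeGroupType)
    (divA : {fraction A} -> DivA) (divB : {fraction B} -> DivB),
    is_div divA -> is_div divB ->
  let extends_div (phi : DivA -> DivB) :=
    lg_morphism phi /\
    forall a : A, a != 0 ->
      phi (divA (tofrac a)) = divB (tofrac (integral_base f a)) in
  exists phi : DivA -> DivB,
    [/\ extends_div phi,
        forall psi : DivA -> DivB, extends_div psi -> psi =1 phi,
        injective phi &
        forall (x : B) (p : {poly A}) (d : nat),
          x != 0 -> p \is monic -> size p = d.+1 ->
          root (map_poly f p) (integral_val x) ->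
          let xi := divB (tofrac x) in
          let D := (\big[lcmn/1]_(1 <= i < d.+1) i)%N in
          let coef_divs := [seq divA (tofrac c) | c <- p : seq A & c != 0] in
          exists (gamma : DivA) (gammas : seq DivA),
            {in gamma :: gammas, forall g, inIntSpan (in_tuple coef_divs) g} /\
            lg_inf (lg_abs (xi *+ D - phi gamma))
                   [seq lg_abs (xi *+ D - phi g) | g <- gammas] = 0].
Proof.
move=> f B pvmd_A; split; first exact: integral_closure_with_divisors.
move=> DivA DivB divA divB is_divA is_divB extends_div.
have [phi [phi_morphism phiE phi_uniq phi_inj]] :=
  div_extension pvmd_A is_divA is_divB.
exists phi; split=> // [psi [psi_morphism psiE]|x p d nz_x mon_p size_p root_p
  xi D s].
  exact: phi_uniq.
have [g [gs [gsP inf0]]] :=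
  inf_abs_lcm_sub_coef_gamma is_divB phi_morphism phiE nz_x size_p root_p.
exists g, gs; split=> // y /gsP[i [j [pi pj lt_ij ->]]].
have coef_in k : k \in coef_support p -> rdiv divA p`_k \in s.
  rewrite mem_filter mem_index_iota => /andP[nz_pk /andP[_ lt_kp]].
  by apply: (map_f (rdiv divA)); rewrite mem_filter nz_pk mem_nth.
by apply/inIntSpan_mulrn/inIntSpan_sub; apply/inIntSpan_mem/coef_in.
Qed.
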